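(* Let $\varphi_t(x)$, $t\ge0$, $x\in\mathbb{R}^2_+$, be the reflecting flow in the half-plane solving $$d\varphi_t(x)=A\varphi_t(x)\,dt+dw(t)+n\,L(dt,x),\quad \varphi_0(x)=x,\qquad A=\begin{pmatrix}1&1\\1&1\end{pmatrix},$$ and let $f_t(x)=f_t(x_1,x_2)$ be the random function defined in the context. Then for all $t>0$: 1) for all $x_2>0$ and almost all $\omega\in\Omega$ the function $x_1\mapsto f_t(x_1,x_2)$ is nondecreasing in $x_1$; 2) for any $x=(x_1,x_2)$ with $x_2>0$ and almost all $\omega\in\{\sigma(x)<t\}$ the function $f_t(\cdot)$ is discontinuous in any neighborhood of $x$ (i.e. every neighborhood of $x$ contains a point of discontinuity of $f_t$). Moreover, for any $x=(x_1,x_2)$ with $x_2>0$ and any $\delta>0$, $$P\Bigl(\{\text{the function } f_t(\cdot,x_2)\text{ does not have a jump discontinuity on }(x_1-\delta,x_1+\delta)\}\cap\{\sigma(x)<t\}\Bigr)=0 .$$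
   Context: $\mathbb{R}^2_+=\mathbb{R}\times[0,\infty)$, $\partial\mathbb{R}^2_+=\mathbb{R}\times\{0\}$, $n=(0,1)$, and $w$ is a Wiener process in $\mathbb{R}^2$. The solution of the reflected equation satisfies (in integral form) the equation with $\varphi_t(x)\in\mathbb{R}^2_+$, where $L(t,x)$ is continuous and non-decreasing in $t$, $L(0,x)=0$, and $\int_0^t\mathbf{1}_{\varphi_s(x)\in\partial\mathbb{R}^2_+}L(ds,x)=L(t,x)$ for all $t\ge0$. For every $\omega$ the solution exists, is unique, and is continuous in $(t,x)$. $\sigma(x)=\inf\{t\ge0:\varphi_t(x)\in\partial\mathbb{R}^2_+\}$ and $\tau(t,x)=\sup\{s\in[0,t]:\varphi_s(x)\in\partial\mathbb{R}^2_+\}$. The $(\sigma_k(x),\tau_k(x))$ are the disjoint open intervals (connected components) with $\bigcup_k(\sigma_k(x),\tau_k(x))=\{t>\sigma(x):\varphi_t(x)\notin\partial\mathbb{R}^2_+\}$, and $\Delta_k(x)=\tau_k(x)-\sigma_k(x)$. The function $f_t$ is defined by $$f_t(x)=\frac{e^{2(t-\tau(t,x))}+1}{2}\cdot\frac{e^{2\sigma(x)}+1}{2}\prod_{k:\,[\sigma_k(x),\tau_k(x)]\subset(0,t)}\frac{e^{2\Delta_k(x)}+1}{2}\quad\text{for } t\ge\sigma(x),$$ and $f_t(x)=\frac{e^{2t}+1}{2}$ for $t<\sigma(x)$. (The product is a product of real numbers greater than 1, so its value does not depend on the order; an empty product is 1.) *)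

(* Defs.v *)
From HB Require Import structures.
From mathcomp Require Import all_boot all_order all_algebra finmap.
From mathcomp Require Import all_classical all_reals all_analysis.

Set Implicit Arguments.
Unset Strict Implicit.
Unset Printing Implicit Defensive.

Import Order.TTheory GRing.Theory Num.Theory.
Import numFieldNormedType.Exports.
Local Open Scope classical_set_scope.
Local Open Scope ring_scope.

Section HalfPlane.
Context {R : realType}.

Definition vec2 (a b : R) : 'cV[R]_2 := \col_(i < 2) [:: a; b]`_i.

Definition half_plane : set 'cV[R]_2 := [set x | 0 <= x 1 0].

Definition boundary : set 'cV[R]_2 := [set x | x 1 0 = 0].

Definition inward_normal : 'cV[R]_2 := vec2 0 1.

Definition drift : 'M[R]_2 := const_mx 1.

End HalfPlane.

Section WienerProcess.
Context {R : realType} (d : measure_display) (Omega : measurableType d).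
Variable P : probability Omega R.

(* The product rule for the full family implies the one for every subfamily,
   by taking [B i = setT] for the remaining indices. *)
Definition mutually_independent (I : finType) (X : I -> Omega -> R) : Prop :=
  forall B : I -> set R, (forall i, measurable (B i)) ->
    P (\bigcap_i (X i @^-1` B i)) = (\prod_(i : I) P (X i @^-1` B i))%E.

Definition wiener_process (w : R -> Omega -> 'cV[R]_2) : Prop :=
  [/\ forall omega, w 0 omega = 0,
      forall omega, {within `[0, +oo[, continuous (fun t => w t omega)},
      forall t i, 0 <= t ->
        measurable_fun [set: Omega] (fun omega => w t omega i 0),
      (* Independence is over both the time steps and the two coordinates. *)
      forall (m : nat) (s : R^nat), 0 <= s 0%N -> nondecreasing_seq s ->
        @mutually_independent ('I_m * 'I_2)%type
          (fun ki omega => (w (s ki.1.+1) omega - w (s ki.1) omega) ki.2 0)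
    & forall s t i (B : set R), 0 <= s -> s < t -> measurable B ->
        P ((fun omega => (w t omega - w s omega) i 0) @^-1` B) =
        normal_prob 0 (Num.sqrt (t - s)) B].

End WienerProcess.

Section ReflectingFlow.
Context {R : realType}.

(* [lebesgue_stieltjes_measure] needs a distribution function on the whole line:
   [l] is extended by [l 0] to the negative half-line, which adds no mass. *)
Definition regulator (y : R -> 'cV[R]_2) (l : R -> R) : Prop :=
  [/\ {within `[0, +oo[, continuous l},
      forall s t, 0 <= s -> s <= t -> l s <= l t,
      l 0 = 0
    & exists2 F : cumulative R R, forall t, F t = l (Num.max t 0) &
        forall t, 0 <= t ->
          (\int[lebesgue_stieltjes_measure F]_(s in `[0%R, t])
             (\1_[set r | boundary (y r)] s)%:E)%E = (l t)%:E].

Definition reflected_solution (w : R -> 'cV[R]_2) (x : 'cV[R]_2)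
    (y : R -> 'cV[R]_2) (l : R -> R) : Prop :=
  [/\ forall t, 0 <= t -> half_plane (y t),
      regulator y l
    & forall t (i : 'I_2), 0 <= t ->
        y t i 0 = x i 0
                + \int[lebesgue_measure]_(s in `[0, t]) (drift *m y s) i 0
                + w t i 0 + inward_normal i 0 * l t].

Definition reflecting_flow (w : R -> 'cV[R]_2)
    (phi : R -> 'cV[R]_2 -> 'cV[R]_2) (L : R -> 'cV[R]_2 -> R) : Prop :=
  {within [set p : R * 'cV[R]_2 | 0 <= p.1 /\ half_plane p.2],
     continuous (fun p => phi p.1 p.2)} /\
  forall x, half_plane x -> reflected_solution w x (phi^~ x) (L^~ x).

End ReflectingFlow.

Section RandomFunction.
Context {R : realType}.
Variable phi : R -> 'cV[R]_2 -> 'cV[R]_2.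
Implicit Types (x : 'cV[R]_2) (t : R) (I : R * R).

(* [+oo] when the boundary is never reached. *)
Definition hitting_time x : \bar R :=
  ereal_inf [set t%:E | t in [set t | 0 <= t /\ boundary (phi t x)]].

Definition last_hit t x : R :=
  sup [set s | 0 <= s <= t /\ boundary (phi s x)].

Definition off_boundary x : set R :=
  [set t | (hitting_time x < t%:E)%E /\ ~ boundary (phi t x)].

(* An excursion is encoded by its endpoints; an unbounded last component is not
   represented, as it never satisfies the constraint in [past_excursions]. *)
Definition excursions x : set (R * R) :=
  [set I | exists2 s, off_boundary x s &
     connected_component (off_boundary x) s = `]I.1, I.2[%classic].

Definition past_excursions t x : set (R * R) :=
  [set I | excursions x I /\ `[I.1, I.2]%classic `<=` `]0, t[%classic].

(* Unordered product of a family of factors that are all at least 1: the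
   supremum of its finite partial products, hence 1 over the empty set. *)
Definition prod_ge1 (T : choiceType) (J : set T) (a : T -> R) : R :=
  sup [set \prod_(k <- F) a k | F in [set F : {fset T} | [set` F] `<=` J]].

Definition stretch (u : R) : R := (expR (2 * u) + 1) / 2.

Definition flow_factor t x : R :=
  if (t%:E < hitting_time x)%E then stretch t
  else stretch (t - last_hit t x) * stretch (fine (hitting_time x)) *
       prod_ge1 (past_excursions t x) (fun I => stretch (I.2 - I.1)).

End RandomFunction.

Section Discontinuities.
Context {R : realType}.

(* Continuity at [y] of a function on the closed half-plane, whatever the values
   taken by its total extension outside of it. *)
Definition half_plane_continuous_at (f : 'cV[R]_2 -> R) (y : 'cV[R]_2) : Prop :=
  f z @[z --> within half_plane (nbhs y)] --> f y.

Definition jump_discontinuity (g : R -> R) (a : R) : Prop :=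
  exists l r : R, [/\ l != r, g z @[z --> a^'-] --> l & g z @[z --> a^'+] --> r].

End Discontinuities.

(* Main.v *)
Require Import Defs.
From HB Require Import structures.
From mathcomp Require Import all_boot all_order all_algebra finmap.
From mathcomp Require Import all_classical all_reals all_analysis.
From mathcomp Require Import measurable_realfun ring lra.

Set Implicit Arguments.
Unset Strict Implicit.
Unset Printing Implicit Defensive.

Import Order.TTheory GRing.Theory Num.Theory.
Import numFieldNormedType.Exports.
Local Open Scope classical_set_scope.
Local Open Scope ring_scope.

(** Write [y = phi _ x] for the trajectory started at [x], [Z(x)] for the set of
    times at which it lies on the boundary, and [w2] for the second coordinate
    of [w].

    Probability enters once. For fixed [q > 0], almost surely no constant [N]
    satisfies [w2 q - w2 s <= N (q - s)] for all [s] in [[0, q]]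
    ([wiener_left_lipschitz_negligible]). If [y q] is on the boundary, then the
    second coordinate of [y] is [0] at [q] and nonnegative before, the regulator
    is nondecreasing and the drift is bounded on [[0, q]], so such an [N] exists
    ([boundary_left_lipschitz]). Hence, outside one null set, for [q = t] and for
    every rational [q > 0], no trajectory from the half-plane is on the boundary
    at time [q] ([boundary_at_rationals_negligible]). The rest is deterministic.

    The system is cooperative, so trajectories are ordered like their starting
    points ([comparison]), and [Z(x')] is contained in [Z(x)] when [x <= x'].
    When neither [0] nor [t] is in [Z(x)], the number [f_t(x)] is the supremum,
    over finite families of disjoint intervals of [[0, t]] avoiding [Z(x)], of
    the products of the factors [(e^(2u) + 1) / 2] of their lengths [u]
    ([flow_factorE]): these factors are supermultiplicative, so it is best to take
    whole gaps. In this form [f_t(x)] obviously increases when [Z(x)] shrinks,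
    which is the monotonicity claim.

    For the jump, let [sigma(z)] be the hitting time of the trajectory from
    [(z, x2)]. It is strictly increasing in [z] ([flow_before_hit_lt]) and avoids
    the rationals. Choose a rational [q] between [sigma(z0)] and [sigma(x1)], with
    [z0 < x1] close to [x1], and let [a] be the point where [sigma] crosses [q].
    The trajectory from [(a, x2)] is off the boundary at time [q], hence so are
    the nearby ones at nearby times, and [sigma(z) <= q - e] for [z < a] close to
    [a], while [sigma(z') > q] for [z' > a]. Merging the two pieces of
    [[0, sigma(z')]] cut at [sigma(z)] increases the product by a constant that
    does not depend on [z] and [z'] ([gap_product_gain]), so [f_t] jumps at [a].
*)

(** * Bounds for the normal distribution *)

Section NormalBounds.
Context {R : realType}.
Implicit Types s c a : R.

Lemma measurable_EFin_normal_pdf m s (D : set R) :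
  measurable_fun D (fun x => (normal_pdf m s x)%:E).
Proof.
apply: measurable_funTS; apply/measurable_EFinP; exact: measurable_normal_pdf.
Qed.

(** The density of standard deviation [s] is compared with the one of standard
    deviation [2 * s], whose total mass is 1. *)
Lemma normal_prob_tail s a : 0 < s -> 0 < a ->
  (normal_prob 0 s [set x : R | (a < `|x|)%R] <= (6 * s ^+ 2 / a ^+ 2)%:E)%E.
Proof.
move=> s0 a0; have s20 : 0 < s ^+ 2 by rewrite exprn_gt0.
have a20 : 0 < a ^+ 2 by rewrite exprn_gt0.
set K := 2 * expR (- (3 * a ^+ 2 / (8 * s ^+ 2))).
have K0 : 0 <= K by rewrite mulr_ge0// expR_ge0.
have mA : measurable [set x : R | a < `|x|].
  rewrite [X in measurable X](_ : _ = Num.norm @^-1` `]a, +oo[).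
    by rewrite -[X in measurable X]setTI; exact: normr_measurable.
  by apply/seteqP; split => x /=; rewrite in_itv/= andbT.
have s1 : s != 0 by rewrite gt_eqF.
have s2 : 2 * s != 0 by rewrite mulf_neq0.
have pdfle x : a < `|x| -> normal_pdf 0 s x <= K * normal_pdf 0 (2 * s) x.
  move=> ax; rewrite !normal_pdfE// /normal_peak /normal_fun !subr0.
  have -> : (2 * s) ^+ 2 * pi *+ 2 = (2 ^+ 2) * (s ^+ 2 * pi *+ 2) by ring.
  rewrite sqrtrM ?sqr_ge0// sqrtr_sqr ger0_norm// invfM.
  rewrite /K; set p := (Num.sqrt _)^-1.
  rewrite [leRHS](_ : _ = p * (expR (- (3 * a ^+ 2 / (8 * s ^+ 2))) * expR (- x ^+ 2 / ((2 * s) ^+ 2 *+ 2)))); last first.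
    by field.
  rewrite ler_wpM2l ?invr_ge0// -expRD ler_expR.
  have ax2 : a ^+ 2 <= x ^+ 2.
    by rewrite -[x ^+ 2]real_normK ?num_real// ler_sqr ?nnegrE// ltW.
  rewrite -subr_ge0.
  rewrite (_ : _ - _ = 3 * (x ^+ 2 - a ^+ 2) / (8 * s ^+ 2)); last by field.
  by apply: divr_ge0; apply: mulr_ge0 => //; rewrite ?subr_ge0// ltW.
apply: (@le_trans _ _ (K%:E)).
  apply: (@le_trans _ _ (\int[lebesgue_measure]_(x in [set x : R | (a < `|x|)%R])
      (K%:E * (normal_pdf 0 (2 * s) x)%:E))%E).
    apply: ge0_le_integral => //.
    - by move=> x _; rewrite lee_fin normal_pdf_ge0.
    - exact: measurable_EFin_normal_pdf.
    - apply: measurable_funeM.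
      exact: measurable_EFin_normal_pdf.
  rewrite ge0_integralZl//; last 2 first.
    exact: measurable_EFin_normal_pdf.
    by move=> x _; rewrite lee_fin normal_pdf_ge0.
  rewrite -[leRHS]mule1 lee_wpmul2l ?lee_fin//.
  rewrite -(integral_normal_pdf 0 (2 * s)).
  apply: ge0_subset_integral => //.
  - by apply/measurable_EFinP; exact: measurable_normal_pdf.
  - by move=> x _; rewrite lee_fin normal_pdf_ge0.
rewrite lee_fin /K expRN.
set y := 3 * a ^+ 2 / (8 * s ^+ 2).
have y0 : 0 < y by rewrite divr_gt0 ?mulr_gt0.
apply: (@le_trans _ _ (2 / y)).
  rewrite ler_pM2l// lef_pV2 ?posrE ?expR_gt0//.
  by rewrite (le_trans _ (expR_ge1Dx y))// lerDr.
rewrite /y invfM invrK.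
rewrite -subr_ge0 (_ : _ - _ = (2 / 3) * s ^+ 2 / a ^+ 2); last first.
  by field; rewrite gt_eqF.
by rewrite divr_ge0 ?mulr_ge0 ?ltW ?divr_gt0.
Qed.

(** A lower bound for the probability that a centred normal variable exceeds its
    standard deviation. *)
Definition gauss_lb : R := expR (- 2) / Num.sqrt (pi *+ 2).

Lemma gauss_lb_gt0 : 0 < gauss_lb.
Proof. by rewrite divr_gt0 ?expR_gt0// sqrtr_gt0 pmulrn_rgt0// pi_gt0. Qed.

(** The density is at least [gauss_lb / s] on [`]s, 2 * s]], of length [s]. *)
Lemma normal_prob_upper s c : 0 < s -> c <= s ->
  (gauss_lb%:E <= normal_prob 0 s `]c, +oo[)%E.
Proof.
move=> s0 cs; have s1 : s != 0 by rewrite gt_eqF.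
have lb x : x \in `]s, (2 * s)] -> gauss_lb / s <= normal_pdf 0 s x.
  rewrite in_itv/= => /andP[sx xs].
  rewrite normal_pdfE// /normal_peak /normal_fun subr0.
  have -> : s ^+ 2 * pi *+ 2 = s ^+ 2 * (pi *+ 2) by ring.
  rewrite sqrtrM ?sqrtr_sqr ?sqr_ge0// gtr0_norm// invfM /gauss_lb.
  set p := (Num.sqrt (pi *+ 2))^-1.
  rewrite (_ : expR (- 2) * p / s = s^-1 * p * expR (- 2)); last by ring.
  rewrite ler_wpM2l ?mulr_ge0 ?invr_ge0 ?sqrtr_ge0// ?(ltW s0)// ler_expR.
  rewrite mulNr lerN2 ler_pdivrMr ?pmulrn_rgt0 ?exprn_gt0//.
  have : x ^+ 2 <= (2 * s) ^+ 2.
    by rewrite ler_sqr ?nnegrE ?mulr_ge0// ?ltW// (lt_trans s0).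
  by rewrite exprMn -mulr_natl; lra.
have le1 : (gauss_lb%:E <=
    \int[lebesgue_measure]_(x in `]s, (2 * s)%R]) (gauss_lb / s)%:E)%E.
  rewrite integral_cst//= lebesgue_measure_itv/= lte_fin.
  rewrite ltr_pMl// ltr1n -EFinD -EFinM lee_fin.
  by rewrite (_ : 2 * s - s = s) ?mulfVK//; ring.
have le2 : (\int[lebesgue_measure]_(x in `]s, (2 * s)%R]) (gauss_lb / s)%:E <=
    normal_prob 0 s `]s, (2 * s)%R])%E.
  apply: ge0_le_integral => //=.
  - by move=> x _; rewrite lee_fin divr_ge0// ltW// gauss_lb_gt0.
  - exact: measurable_EFin_normal_pdf.
apply: (le_trans le1); apply: (le_trans le2).
apply: ge0_subset_integral => //.
- exact: measurable_EFin_normal_pdf.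
- by move=> x _; rewrite lee_fin normal_pdf_ge0.
- move=> x /=; rewrite !in_itv/= andbT => /andP[sx _].
  exact: le_lt_trans sx.
Qed.

End NormalBounds.

(** * Steep increments of the Wiener process *)

Section Wiener.
Context {R : realType} (d : measure_display) (Omega : measurableType d).
Variable P : probability Omega R.

(** No measurability of [E] is required. *)
Lemma negligible_small (E : set Omega) :
  (forall e : R, 0 < e ->
     exists B, [/\ measurable B, E `<=` B & (P B <= e%:E)%E]) ->
  P.-negligible E.
Proof.
move=> H; have H' n : exists B, [/\ measurable B, E `<=` B & (P B <= (n.+1%:R^-1)%:E)%E].
  by apply: H; rewrite invr_gt0 ltr0n.
pose B n := sval (cid (H' n)).
have BP n : [/\ measurable (B n), E `<=` B n & (P (B n) <= (n.+1%:R^-1)%:E)%E].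
  by rewrite /B; case: cid.
have mI : measurable (\bigcap_n B n).
  by apply: bigcapT_measurable => n; have [] := BP n.
exists (\bigcap_n B n); split => //; last first.
  by move=> x Ex n _; have [_ + _] := BP n; exact.
apply/eqP; rewrite eq_le measure_ge0 andbT.
apply/lee_addgt0Pr => e e0; rewrite add0e.
have [n ne] : exists n : nat, n.+1%:R^-1 < e.
  by have /ltr_add_invr[k] := e0; rewrite add0r => ?; exists k.
have [mB _ PB] := BP n.
apply: le_trans (le_trans PB _); last by rewrite lee_fin ltW.
by apply: le_measure; rewrite ?inE//; exact: bigcap_inf.
Qed.

Variable w : R -> Omega -> 'cV[R]_2.
Hypothesis hw : wiener_process P w.

(* Increment over [[s, t]] of the second coordinate. *)
Let incr s t omega : R := (w t omega - w s omega) 1 0.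

Lemma measurable_incr s t : 0 <= s -> 0 <= t -> measurable_fun setT (incr s t).
Proof.
move=> s0 t0; have [_ _ mw _ _] := hw.
rewrite /incr; under eq_fun do rewrite !mxE.
by apply: measurable_funB; exact: mw.
Qed.

Lemma incr_tail s t a : 0 <= s -> s < t -> 0 < a ->
  (P [set omega | (a < `|incr s t omega|)%R] <= (6 * (t - s) / a ^+ 2)%:E)%E.
Proof.
move=> s0 st a0; have [_ _ mw _ gw] := hw.
have ts0 : 0 < t - s by rewrite subr_gt0.
have := gw s t 1 [set x : R | a < `|x|] s0 st.
rewrite (_ : _ @^-1` _ = [set omega | (a < `|incr s t omega|)%R])// => ->.
  rewrite -{2}(sqr_sqrtr (ltW ts0)); apply: normal_prob_tail => //.
  by rewrite sqrtr_gt0.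
rewrite [X in measurable X](_ : _ = Num.norm @^-1` `]a, +oo[).
  by rewrite -[X in measurable X]setTI; exact: normr_measurable.
by apply/seteqP; split => x /=; rewrite in_itv/= andbT.
Qed.

Lemma incr_le s t c : 0 <= s -> s < t -> c <= Num.sqrt (t - s) ->
  (P (incr s t @^-1` `]-oo, c]) <= (1 - gauss_lb)%:E)%E.
Proof.
move=> s0 st cts; have [_ _ mw _ gw] := hw.
have ts0 : 0 < t - s by rewrite subr_gt0.
have mI : measurable (incr s t @^-1` `]c, +oo[).
  rewrite -[X in measurable X]setTI; apply: measurable_incr => //.
  exact: le_trans (ltW st).
have -> : incr s t @^-1` `]-oo, c] = ~` (incr s t @^-1` `]c, +oo[).
  by apply/seteqP; split => x /=; rewrite !in_itv/= andbT leNgt => /negP.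
rewrite probability_setC// EFinB leeB// (gw s t 1 `]c, +oo[%classic s0 st)//.
by apply: normal_prob_upper => //; rewrite sqrtr_gt0.
Qed.

Lemma incr_all_le (n : nat) (s : R^nat) (c : R^nat) :
  0 <= s 0%N -> (forall k, s k < s k.+1) ->
  (forall k, c k <= Num.sqrt (s k.+1 - s k)) ->
  (P (\bigcap_(k in `I_n) (incr (s k) (s k.+1) @^-1` `]-oo, c k]))
     <= ((1 - gauss_lb) ^+ n)%:E)%E.
Proof.
move=> s0 slt cs; have [_ _ _ iw _] := hw.
have snd : nondecreasing_seq s by apply/nondecreasing_seqP => k; exact/ltW.
have sge k : 0 <= s k by rewrite (le_trans s0)// snd.
(* No constraint is put on the increments of the first coordinate. *)
pose B (ki : 'I_n * 'I_2) : set R :=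
  if ki.2 == 1 then `]-oo, c ki.1]%classic else setT.
have mB ki : measurable (B ki) by rewrite /B; case: ifP.
have := iw n s s0 snd B mB.
set X := \bigcap_i _; rewrite (_ : X = \bigcap_(k in `I_n) (incr (s k) (s k.+1) @^-1` `]-oo, c k])); last first.
  apply/seteqP; split => [x Xx k /= kn|x Xx [k i] _].
    have := Xx (Ordinal kn, 1) I.
    by rewrite /B.
  rewrite /B /=; case: ifPn => // /eqP ->.
  exact: (Xx (k : nat) (ltn_ord k)).
move=> ->.
rewrite (_ : (\prod_i _)%E = (\prod_(k < n) P (incr (s k) (s k.+1) @^-1` `]-oo, c k]))%E); last first.
  rewrite -(pair_bigA _ (fun (k : 'I_n) (i : 'I_2) => P ((fun omega => (w (s k.+1) omega - w (s k) omega)%R i 0%R) @^-1` B (k, i)))%E)/=.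
  apply: eq_bigr => k _; rewrite !big_ord_recl big_ord0 mule1.
  rewrite [X in (X * _)%E](_ : _ = 1%E); last first.
    by rewrite /B/= preimage_setT probability_setT.
  rewrite mul1e (_ : lift ord0 ord0 = 1)//; exact/val_inj.
elim: n {B mB X} => [|n IH]; first by rewrite big_ord0 expr0.
rewrite big_ord_recr/= exprSr EFinM; apply: lee_pmul => //.
- by apply: prode_ge0 => i _.
- by apply: incr_le.
Qed.

(** For the times [s k = q - h0 * th ^+ k], the increment from [s k] to [q] is
    dominated by the one from [s k] to [s k.+1] when [th] is small. On the event,
    each of the latter is at most [c k], of the order of its standard deviation,
    unless the increment from [s k.+1] to [q] is exceptionally large. The first
    possibility has probability at most [(1 - gauss_lb) ^+ n] for [n] steps, by
    independence, and the second one at most [48 * n * th]. *)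
Lemma wiener_left_lipschitz_negligible q : 0 < q ->
  P.-negligible [set omega | exists N : R, forall s, 0 <= s <= q ->
     incr s q omega <= N * (q - s)].
Proof.
move=> q0.
pose E (N : nat) := [set omega | forall s, 0 <= s <= q ->
     incr s q omega <= N%:R * (q - s)].
apply: (@negligibleS _ _ _ _ (\bigcup_N E N)).
  move=> omega [N HN]; have [m Nm] : exists m : nat, N <= m%:R.
    by exists (Num.truncn `|N|).+1; rewrite (le_trans (ler_norm _))// ltW// truncnS_gt.
  exists m => // s sq; rewrite (le_trans (HN s sq))// ler_wpM2r//.
  by rewrite subr_ge0; case/andP: sq.
apply: negligible_bigcup => N; apply: negligible_small => e e0.
pose r : R := 1 - gauss_lb.
have r1 : r < 1 by rewrite gtrBl gauss_lb_gt0.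
have r0 : 0 <= r.
  have := @incr_le 0 q 0 (lexx _) q0 (sqrtr_ge0 _).
  by move=> /(le_trans (measure_ge0 _ _)); rewrite lee_fin.
have [n rn] : exists n : nat, r ^+ n <= e / 2.
  have /cvgrPdist_le/(_ (e / 2)) : r ^+ n @[n --> \oo] --> 0.
    by apply: cvg_expr; rewrite ger0_norm.
  rewrite divr_gt0// => /(_ isT)[n _ /(_ n (leqnn n))].
  by rewrite /= sub0r normrN ger0_norm ?exprn_ge0// => ?; exists n.
(* [96] makes the [n] exceptional events, of probability [48 * th] each, cost at
   most [e / 2]. *)
pose th : R := Num.min (2^-1) (e / (96 * n.+1%:R)).
have th0 : 0 < th.
  by rewrite lt_min; apply/andP; split; [|apply: divr_gt0 => //; apply: mulr_gt0].
have th2 : th <= 2^-1 by rewrite ge_min lexx.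
have the : th <= e / (96 * n.+1%:R) by rewrite ge_min lexx orbT.
(* This choice of [h0] gives [N%:R * h k <= c k / 2] for all [k]. *)
pose h0 : R := Num.min q (8 * N.+1%:R ^+ 2)^-1.
have h00 : 0 < h0.
  by rewrite lt_min q0 /= invr_gt0; apply: mulr_gt0 => //; apply: exprn_gt0.
have h0q : h0 <= q by rewrite ge_min lexx.
have h0N : h0 <= (8 * N.+1%:R ^+ 2)^-1 by rewrite ge_min lexx orbT.
pose h k := h0 * th ^+ k.
have hS k : h k.+1 = th * h k by rewrite /h exprS; ring.
have hgt0 k : 0 < h k by rewrite mulr_gt0// exprn_gt0.
have hle k : h k <= h0.
  by rewrite ler_piMr ?(ltW h00)// exprn_ile1 ?(ltW th0)// (le_trans th2)// invf_le1// ler1n.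
have hS2 k : h k.+1 <= h k / 2 by rewrite hS mulrC ler_pM2l.
pose s k := q - h k.
have sq k : s k < q by rewrite gtrBl.
have s_ge0 k : 0 <= s k by rewrite subr_ge0 (le_trans (hle k)).
have sS k : s k < s k.+1.
  by rewrite ltrD2l ltrN2; have := hS2 k; have := hgt0 k; lra.
pose c k := Num.sqrt (h k / 2).
have c_le k : c k <= Num.sqrt (s k.+1 - s k).
  apply: ler_wsqrtr; rewrite /s; have := hS2 k; lra.
have c0 k : 0 < c k by rewrite sqrtr_gt0 divr_gt0.
pose B1 := \bigcap_(k in `I_n) (incr (s k) (s k.+1) @^-1` `]-oo, c k]).
pose B2 := \big[setU/set0]_(k < n)
   [set omega | (c k / 2 < `|incr (s k.+1) q omega|)%R].
have mB1 : measurable B1.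
  apply: bigcap_measurableType => k _.
  by rewrite -[X in measurable X]setTI; apply: measurable_incr.
have mB2 k : measurable [set omega | (c k / 2 < `|incr (s k.+1) q omega|)%R].
  rewrite [X in measurable X](_ : _ = (Num.norm \o incr (s k.+1) q) @^-1` `](c k / 2), +oo[).
    rewrite -[X in measurable X]setTI.
    apply: (measurableT_comp (@normr_measurable _ setT)) => //.
    by apply: measurable_incr => //; exact: ltW.
  by apply/seteqP; split => x /=; rewrite in_itv/= andbT.
exists (B1 `|` B2); split.
- apply: measurableU => //; apply: bigsetU_measurable => k _; exact: mB2.
- move=> omega Eo; apply/or_asboolP; rewrite -implyNb; apply/implyP.
  move=> /asboolPn nB1; apply/asboolP.
  apply: contrapT => nB2; apply: nB1 => k /= kn; rewrite in_itv/=.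
  have Rk : `|incr (s k.+1) q omega| <= c k / 2.
    rewrite leNgt; apply/negP => H; apply: nB2.
    by rewrite /B2 -(bigcup_mkord n (fun k => [set omega | (c k / 2 < `|incr (s k.+1) q omega|)%R])); exists k.
  have Ek : incr (s k) q omega <= c k / 2.
    have sk : 0 <= s k <= q by rewrite s_ge0 ltW.
    apply: (le_trans (Eo _ sk)).
    rewrite (_ : q - s k = h k); last by rewrite /s; ring.
    have : (N%:R * h k) ^+ 2 <= (c k / 2) ^+ 2.
      have -> : (N%:R * h k) ^+ 2 = h k * (N%:R ^+ 2 * h k) by ring.
      have -> : (c k / 2) ^+ 2 = h k * 8^-1.
        by rewrite expr_div_n /c sqr_sqrtr; [field|rewrite divr_ge0// ltW].
      have Nh : N%:R ^+ 2 * h k <= 8^-1.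
        apply: (@le_trans _ _ (N.+1%:R ^+ 2 * (8 * N.+1%:R ^+ 2)^-1)).
          apply: ler_pM; rewrite ?exprn_ge0// ?(ltW (hgt0 k))//.
            by rewrite ler_sqr ?nnegrE// ler_nat.
          exact: le_trans (hle k) h0N.
        by rewrite invfM mulrCA mulfV ?mulr1// gt_eqF// exprn_gt0.
      apply: ler_wpM2l => //; exact: (ltW (hgt0 k)).
    rewrite ler_sqr// nnegrE; last by apply: divr_ge0 => //; exact/ltW.
    by apply: mulr_ge0 => //; exact: (ltW (hgt0 k)).
  have -> : incr (s k) (s k.+1) omega = incr (s k) q omega - incr (s k.+1) q omega.
    by rewrite /incr !mxE; ring.
  have := ler_norm (- incr (s k.+1) q omega); rewrite normrN.
  lra.
- apply: (@le_trans _ _ ((e / 2)%:E + (e / 2)%:E)%E); last first.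
    by rewrite -EFinD -splitr.
  apply: (le_trans (measureU2 _ _ _)) => //.
    by apply: bigsetU_measurable => k _; exact: mB2.
  apply: leeD.
    by apply: (le_trans (@incr_all_le n s c (s_ge0 0%N) sS c_le)); rewrite lee_fin.
  apply: (@le_trans _ _ (\sum_(k < n) (48 * th)%:E)%E).
    apply: (le_trans (Boole_inequality P (fun k _ => mB2 k))).
    apply: lee_sum => k _.
    apply: (le_trans (@incr_tail (s k.+1) q (c k / 2) _ _ _)) => //.
      exact: divr_gt0.
    rewrite lee_fin exprMn sqr_sqrtr; last by rewrite divr_ge0// ltW.
    rewrite (_ : q - _ = th * h k); last by rewrite /s hS; ring.
    rewrite le_eqVlt; apply/orP; left; apply/eqP; field.
    by rewrite gt_eqF.
  rewrite sumEFin lee_fin sumr_const card_ord.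
  apply: (@le_trans _ _ ((48 * (e / (96 * n.+1%:R))) *+ n)).
    by rewrite lerMn2r ler_pM2l// the orbT.
  apply: (@le_trans _ _ ((48 * (e / (96 * n.+1%:R))) *+ n.+1)).
    by rewrite ler_wpMn2l// mulr_ge0// divr_ge0 ?mulr_ge0// ltW.
  rewrite -mulr_natr le_eqVlt; apply/orP; left; apply/eqP; field.
  by rewrite nat1r.
Qed.

End Wiener.

(** * Suprema and intervals of the real line *)

Section RealLine.
Context {R : realType}.

Lemma closed_sup_mem (A : set R) : closed A -> has_sup A -> A (sup A).
Proof.
by move=> cA [A0 uA]; apply: cA; exact: closure_sup.
Qed.

Lemma closed_inf_mem (A : set R) : closed A -> has_inf A -> A (inf A).
Proof.
move=> cA iA; have : closed (-%R @^-1` A).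
  by apply: preimage_closed => // u _; exact: oppr_continuous.
move=> /closed_sup_mem; rewrite (_ : -%R @^-1` A = -%R @` A); last first.
  apply/seteqP; split => [u /= Au|_ [u Au <-] /=]; last by rewrite opprK.
  by exists (- u) => //; rewrite opprK.
by move=> H; have [v Av vE] := H ((has_inf_supN _).2 iA); rewrite /inf -vE opprK.
Qed.

Lemma itvoo_inj (a b c e : R) : a < b ->
  `]a, b[%classic = `]c, e[%classic -> a = c /\ b = e.
Proof.
move=> ab E.
have ce : c < e.
  have : `]a, b[%classic ((a + b) / 2) by rewrite /= in_itv/= !midf_lt.
  by rewrite E /= in_itv/= => /andP[]; exact: lt_trans.
have EE u : (a < u < b) = (c < u < e).
  have := congr1 (fun S : set R => S u) E; rewrite /= !in_itv/= => H.
  by apply/idP/idP; rewrite H.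
have nE u : (a < u < b) != (c < u < e) -> False by rewrite EE eqxx.
split; apply/eqP; rewrite eq_le; apply/andP; split; rewrite leNgt; apply/negP => h.
- have [u /andP[u1 u2]] : exists u, c < u < Num.min a e.
    by exists ((c + Num.min a e) / 2); rewrite !midf_lt// lt_min h.
  by apply: (nE u); move: u2; rewrite lt_min => /andP[ua ->]; rewrite u1 (ltNge a) (ltW ua).
- have [u /andP[u1 u2]] : exists u, a < u < Num.min c b.
    by exists ((a + Num.min c b) / 2); rewrite !midf_lt// lt_min h.
  by apply: (nE u); move: u2; rewrite lt_min => /andP[ua ->]; rewrite u1 (ltNge c) (ltW ua).
- have [u /andP[u1 u2]] : exists u, Num.max a e < u < b.
    by exists ((Num.max a e + b) / 2); rewrite !midf_lt// gt_max h ab.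
  by apply: (nE u); move: u1; rewrite gt_max => /andP[-> ua]; rewrite u2 (ltNge u) (ltW ua) andbF.
- have [u /andP[u1 u2]] : exists u, Num.max c b < u < e.
    by exists ((Num.max c b + e) / 2); rewrite !midf_lt// gt_max h ce.
  by apply: (nE u); move: u1; rewrite gt_max => /andP[-> ua]; rewrite u2 (ltNge u) (ltW ua) andbF.
Qed.

Lemma component_itvoo (A : set R) (l m r : R) : l < m < r ->
  `]l, r[ `<=` A -> ~ A l -> ~ A r ->
  connected_component A m = `]l, r[%classic.
Proof.
move=> lmr lrA nl nr; have Am : A m by apply: lrA; rewrite /= in_itv.
apply/seteqP; split; last first.
  apply: connected_component_max => //.
  by apply/connected_intervalP; exact: interval_is_interval.
move=> u Cu; have itvC := (connected_intervalP _).1 (@component_connected _ A m).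
have CA := @connected_component_sub _ A m.
have Cm : connected_component A m m by exact: connected_component_refl.
have /andP[lm mr] := lmr.
rewrite /= in_itv/= !ltNge; apply/andP; split; apply/negP => h.
  by apply: nl; apply: CA; apply: (itvC _ _ Cu Cm); rewrite h ltW.
by apply: nr; apply: CA; apply: (itvC _ _ Cm Cu); rewrite h ltW.
Qed.

End RealLine.

(** * Continuous functions on the half-line *)

Section HalfLine.
Context {R : realType}.
Notation mu := (@lebesgue_measure R).

(** A continuous function on the closed half-line extends continuously by its
    value at [0]. *)
Lemma continuous_halfline_ext (T : topologicalType) (f : R -> T) :
  {within `[0, +oo[, continuous f} -> continuous (fun u : R => f (Num.max u 0)).
Proof.
move=> /subspace_continuousP cf u.
have m0 : `[0, +oo[%classic (Num.max u 0).
  by rewrite /= in_itv/= andbT le_max lexx orbT.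
apply: (cvg_comp (fun u : R => Num.max u 0) f _ (cf _ m0)).
have cid : {for u, continuous (fun u : R => u : R^o)} by exact: cvg_id.
have cc : {for u, continuous (fun=> 0 : R^o)} by exact: cvg_cst.
move=> B wB.
have : \forall v \near u, `[0, +oo[%classic (Num.max v 0) -> B (Num.max v 0).
  exact: (continuous_max cid cc wB).
apply: filterS => v; apply.
by rewrite /= in_itv/= andbT le_max lexx orbT.
Qed.

Lemma halfline_integrable (f : R -> R) (D : set R) b :
  {within `[0, +oo[, continuous f} -> measurable D -> D `<=` `[0, b] ->
  mu.-integrable D (EFin \o f).
Proof.
move=> cf mD Db.
have : mu.-integrable `[0, b] (EFin \o f); last by apply: integrableS.
apply: continuous_compact_integrable; first exact: segment_compact.
by apply: continuous_subspaceW cf => x /=; rewrite !in_itv/= => /andP[->].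
Qed.

Lemma halfline_RintegralB (f : R -> R) a b :
  {within `[0, +oo[, continuous f} -> 0 <= a -> a <= b ->
  \int[mu]_(u in `[0, b]) f u - \int[mu]_(u in `[0, a]) f u =
  \int[mu]_(u in `]a, b]) f u.
Proof.
move=> cf a0 ab; apply: Rintegral_itvB; rewrite ?bnd_simp//.
by apply: (halfline_integrable (b := b) cf).
Qed.

Lemma halfline_le_Rintegral (f g : R -> R) a b :
  {within `[0, +oo[, continuous f} -> {within `[0, +oo[, continuous g} ->
  0 <= a -> a <= b -> (forall u, a < u <= b -> f u <= g u) ->
  \int[mu]_(u in `]a, b]) f u <= \int[mu]_(u in `]a, b]) g u.
Proof.
move=> cf cg a0 ab fg.
have sub : `]a, b]%classic `<=` `[0, b].
  by move=> x /=; rewrite !in_itv/= => /andP[/ltW/(le_trans a0) -> ->].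
apply: le_Rintegral => //.
- exact: (halfline_integrable cf _ sub).
- exact: (halfline_integrable cg _ sub).
Qed.

Lemma Rintegral_cst_itv (C a b : R) : a <= b ->
  \int[mu]_(u in `]a, b]) C = C * (b - a).
Proof.
move=> ab; rewrite Rintegral_cst//= lebesgue_measure_itv/= lte_fin.
by rewrite lt_neqAle ab andbT; case: eqVneq => [->|_] /=; rewrite ?subrr.
Qed.

Lemma halfline_bound (f : R -> R) b : {within `[0, +oo[, continuous f} ->
  exists C, forall u, 0 <= u <= b -> `|f u| <= C.
Proof.
move=> cf; have [b0|b0] := leP 0 b; last first.
  by exists 0 => u /andP[u0 ub]; have := lt_le_trans b0 (le_trans u0 ub); rewrite ltxx.
have cb : {within `[0, b], continuous f}.
  by apply: continuous_subspaceW cf => x /=; rewrite !in_itv/= => /andP[->].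
have [c1 _ h1] := EVT_max b0 cb; have [c2 _ h2] := EVT_min b0 cb.
exists (`|f c1| + `|f c2|) => u ub.
have := h1 u ub; have := h2 u ub.
have := ler_norm (f c1); have := ler_norm (- f c2); rewrite normrN.
have := normr_ge0 (f c1); have := normr_ge0 (f c2).
by rewrite ler_norml; lra.
Qed.

(** The equality is propagated by steps of length [1 / 4]: at a maximum point [c]
    of [m] up to the next step, [m c <= 2 * (1 / 4) * m c]. *)
Lemma gronwall0 (m : R -> R) : {within `[0, +oo[, continuous m} ->
  (forall s, 0 <= s -> 0 <= m s) ->
  (forall s, 0 <= s -> m s <= 2 * \int[mu]_(u in `[0, s]) m u) ->
  forall s, 0 <= s -> m s = 0.
Proof.
move=> cm m0 mI s s0.
suff H n : forall s, 0 <= s -> s <= n%:R / 4 -> m s = 0.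
  apply: (H (Num.truncn (s * 4)).+1) => //.
  by rewrite ler_pdivlMr// ltW// truncnS_gt.
elim: n => [|n IH] {}s {}s0.
  rewrite mul0r => s0'; have -> : s = 0 by apply/eqP; rewrite eq_le s0' s0.
  apply/eqP; rewrite eq_le m0// andbT.
  by apply: (le_trans (mI _ _)); rewrite // set_itv1 Rintegral_set1 mulr0.
move=> sn; pose a : R := n%:R / 4; have a0 : 0 <= a by rewrite divr_ge0.
have [/IH|as_] := leP s a; first exact.
have cs : {within `[0, s], continuous m}.
  by apply: continuous_subspaceW cm => x /=; rewrite !in_itv/= => /andP[->].
have [c + cmax] := EVT_max s0 cs.
rewrite in_itv/= => /andP[c0 c_le].
suff mc : m c <= 0.
  apply/eqP; rewrite eq_le m0// andbT (le_trans _ mc)// cmax// in_itv/=.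
  by rewrite s0 lexx.
have [/(IH _ c0) -> //|ac] := leP c a.
have := mI _ c0.
have -> : \int[mu]_(u in `[0, c]) m u = \int[mu]_(u in `]a, c]) m u.
  rewrite -halfline_RintegralB// ?ltW//.
  suff -> : \int[mu]_(u in `[0, a]) m u = 0 by rewrite subr0.
  rewrite (eq_Rintegral mu (g := cst 0)); first by rewrite Rintegral_cst// mul0r.
  by move=> x; rewrite inE/= in_itv/= => /andP[x0 xa]; apply: IH.
have : \int[mu]_(u in `]a, c]) m u <= \int[mu]_(u in `]a, c]) m c.
  apply: halfline_le_Rintegral => //; last 2 first.
  - exact: ltW.
  - move=> u /andP[au uc]; apply: cmax.
    by rewrite in_itv/= (le_trans uc)// (le_trans a0)// ltW.
  by move=> x; exact: cvg_cst.
rewrite (Rintegral_cst_itv _ (ltW ac)) => h1 h2.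
have : c - a <= 4^-1.
  rewrite lerBlDl (le_trans c_le)// (le_trans sn)//.
  by rewrite /a -natr1 mulrDl mul1r.
by have := m0 _ c0; nra.
Qed.

End HalfLine.

(** * Reflected paths: regulator and comparison *)

Section Reflected.
Context {R : realType}.
Notation mu := (@lebesgue_measure R).
Variable W : R -> 'cV[R]_2.
Implicit Types (x : 'cV[R]_2) (y : R -> 'cV[R]_2) (l : R -> R).

Lemma driftE (v : 'cV[R]_2) i : (drift *m v) i 0 = v 0 0 + v 1 0.
Proof.
rewrite mxE !big_ord_recl big_ord0 !mxE !mul1r addr0.
by rewrite (_ : lift ord0 ord0 = 1)//; exact: val_inj.
Qed.

Lemma inward_normal0 : @inward_normal R 0 0 = 0. Proof. by rewrite mxE. Qed.

Lemma inward_normal1 : @inward_normal R 1 0 = 1. Proof. by rewrite mxE. Qed.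

Lemma continuous_coord y i : {within `[0, +oo[, continuous y} ->
  {within `[0, +oo[, continuous (fun u => y u i 0)}.
Proof.
move=> cy u; apply: (cvg_comp y (fun M : 'cV[R]_2 => M i 0) (cy u)).
exact: coord_continuous.
Qed.

Lemma continuous_drift y : {within `[0, +oo[, continuous y} ->
  {within `[0, +oo[, continuous (fun u => y u 0 0 + y u 1 0)}.
Proof.
move=> cy u; have c0 := @continuous_coord y 0 cy u.
have c1 := @continuous_coord y 1 cy u.
exact: (cvgD c0 c1).
Qed.

Lemma solution_increment x y l i s t : {within `[0, +oo[, continuous y} ->
  reflected_solution W x y l -> 0 <= s -> s <= t ->
  y t i 0 - y s i 0 = \int[mu]_(u in `]s, t]) (y u 0 0 + y u 1 0) +
    (W t i 0 - W s i 0) + inward_normal i 0 * (l t - l s).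
Proof.
move=> cy [_ _ eqy] s0 st.
rewrite (eqy t) ?(le_trans s0)// (eqy s)//.
rewrite -(halfline_RintegralB (continuous_drift cy) s0 st).
have e r : \int[mu]_(u in `[0, r]) (drift *m y u) i 0 =
    \int[mu]_(u in `[0, r]) (y u 0 0 + y u 1 0).
  by apply: eq_Rintegral => u _; rewrite driftE.
by rewrite !e; ring.
Qed.

(** The regulator does not grow off the boundary. *)
Lemma regulator_cst x y l s t : reflected_solution W x y l ->
  0 <= s -> s <= t -> (forall u, s < u <= t -> ~ boundary (y u)) -> l s = l t.
Proof.
move=> [_ [_ _ _ [F FE lE]] _] s0 st nb.
have t0 := le_trans s0 st.
apply: EFin_inj; rewrite -lE// -lE//.
rewrite integral_mkcond [RHS]integral_mkcond; apply: eq_integral => u _.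
rewrite /patch !mem_setE !in_itv/=; have [u0|//] := leP 0 u.
have [us|su] := leP u s; first by rewrite (le_trans us st).
case: leP => //= ut; rewrite indicE memNset//=.
by apply: nb; rewrite su ut.
Qed.

Lemma boundary_left_lipschitz x y l q : {within `[0, +oo[, continuous y} ->
  reflected_solution W x y l -> 0 < q -> boundary (y q) ->
  exists N, forall s, 0 <= s <= q -> (W q - W s) 1 0 <= N * (q - s).
Proof.
move=> cy sy q0 bq; have [C HC] := halfline_bound q (continuous_drift cy).
exists C => s /andP[s0 sq].
have := solution_increment 1 cy sy s0 sq; rewrite bq inward_normal1.
have [hp [_ lmono _ _] _] := sy.
have := hp s s0; have := lmono s q s0 sq; rewrite /half_plane/=.
have : \int[mu]_(u in `]s, q]) (- C) <=
       \int[mu]_(u in `]s, q]) (y u 0 0 + y u 1 0).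
  apply: halfline_le_Rintegral => //.
  - by move=> u; exact: cvg_cst.
  - exact: continuous_drift.
  - move=> u /andP[su uq]; have := HC u.
    by rewrite uq (le_trans s0 (ltW su)) => /(_ isT); rewrite ler_norml => /andP[].
rewrite Rintegral_cst_itv// !mxE.
by lra.
Qed.

(* Negative part. *)
Let neg (u : R) : R := Num.max 0 (- u).

(** The sum [m] of the negative parts of the two coordinates of [y' - y] satisfies
    [m s <= 2 * \int_0^s m], hence vanishes. For the second coordinate, let [r] be
    the last time before [s] at which it is nonnegative: after [r], the path [y] is
    strictly above [y'], hence off the boundary, so that its regulator is constant
    on [[r, s]] and only the drift can have made the difference decrease. *)
Lemma comparison x x' y y' l l' :
  {within `[0, +oo[, continuous y} -> {within `[0, +oo[, continuous y'} ->
  reflected_solution W x y l -> reflected_solution W x' y' l' ->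
  (forall i, x i 0 <= x' i 0) ->
  forall s i, 0 <= s -> y s i 0 <= y' s i 0.
Proof.
move=> cy cy' sy sy' xx'.
pose D i s := y' s i 0 - y s i 0.
have cD i : {within `[0, +oo[, continuous (D i)}.
  move=> u; have c' := @continuous_coord y' i cy' u.
  have c := @continuous_coord y i cy u.
  exact: (cvgB c' c).
have D0 i : 0 <= D i 0.
  have [_ [_ _ l0 _] eqy] := sy; have [_ [_ _ l0' _] eqy'] := sy'.
  rewrite /D eqy// eqy'// l0 l0' set_itv1 !Rintegral_set1 subr_ge0.
  by have := xx' i; lra.
pose m s := neg (D 0 s) + neg (D 1 s).
have cneg i : {within `[0, +oo[, continuous (fun s => neg (D i s))}.
  move=> u.
  pose T := subspace (`[0, +oo[%classic : set R).
  have c0 : {for u, continuous (fun _ : T => 0 : R^o)} by exact: cvg_cst.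
  have cN : {for u, continuous (fun s : T => - D i s : R^o)}.
    exact: (cvgN (cD i u)).
  exact: (continuous_max c0 cN).
have cm : {within `[0, +oo[, continuous m}.
  by move=> u; exact: (cvgD (cneg 0 u) (cneg 1 u)).
have neg0 u : 0 <= neg u by rewrite /neg le_max lexx.
have negN u : - u <= neg u by rewrite /neg le_max lexx orbT.
have m0 s : 0 <= m s by rewrite addr_ge0.
have dD s : - (D 0 s + D 1 s) <= m s.
  by have := negN (D 0 s); have := negN (D 1 s); rewrite /m; lra.
have cb := continuous_drift cy; have cb' := continuous_drift cy'.
have intB a b : 0 <= a -> a <= b ->
    \int[mu]_(u in `]a, b]) (y u 0 0 + y u 1 0) -
    \int[mu]_(u in `]a, b]) (y' u 0 0 + y' u 1 0) <= \int[mu]_(u in `[0, b]) m u.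
  move=> a0 ab.
  have sub : `]a, b]%classic `<=` `[0, b].
    by move=> z /=; rewrite !in_itv/= => /andP[/ltW/(le_trans a0) -> ->].
  rewrite -RintegralB//; last 2 first.
  - exact: (halfline_integrable cb _ sub).
  - exact: (halfline_integrable cb' _ sub).
  apply: (@le_trans _ _ (\int[mu]_(u in `]a, b]) m u)).
    apply: halfline_le_Rintegral => //.
      by move=> u; exact: (cvgB (cb u) (cb' u)).
    by move=> u _; have := dD u; rewrite /D; lra.
  rewrite -(halfline_RintegralB cm a0 ab) gerBl.
  by apply: Rintegral_ge0.
have bound i s : 0 <= s -> neg (D i s) <= \int[mu]_(u in `[0, s]) m u.
  move=> s0; have I0 : 0 <= \int[mu]_(u in `[0, s]) m u by apply: Rintegral_ge0.
  rewrite {1}/neg ge_max I0 /=.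
  have [Ds|Ds] := leP 0 (D i s); first by rewrite (le_trans _ I0)// oppr_le0.
  have [->|i1] := eqVneq i 0.
    have e := solution_increment 0 cy sy (lexx 0) s0.
    have e' := solution_increment 0 cy' sy' (lexx 0) s0.
    rewrite inward_normal0 in e e'.
    move: (D0 0) (intB _ _ (lexx 0) s0) e e'; rewrite /D; clear; lra.
  have {i1}i1 : i = 1 by case: i i1 {Ds} => [[|[|//]]] // ? _; exact: val_inj.
  subst i.
  (* [r := sup A] is the last time up to [s] at which [D 1] is nonnegative. *)
  pose A := [set u | 0 <= u <= s /\ 0 <= D 1 u].
  have A0 : A 0 by split; rewrite ?lexx.
  have As : has_sup A by split; [exists 0|exists s => u [/andP[]]].
  have AE : A = [set u | 0 <= u] `&` [set u | u <= s] `&`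
                (fun u => D 1 (Num.max u 0)) @^-1` [set z | 0 <= z].
    apply/seteqP; split => u /=.
      by move=> [/andP[u0 us] Du]; rewrite max_l.
    by move=> [[u0 us]]; rewrite max_l// => Du; split=> //; apply/andP.
  have cA : closed A.
    rewrite AE; apply: closedI; first by apply: closedI; [exact: closed_ge|exact: closed_le].
    apply: preimage_closed; last exact: closed_ge.
    by move=> u _; exact: (continuous_halfline_ext (cD 1)).
  have [/andP[r0 rs] Dr] := closed_sup_mem cA As.
  set r := sup A in r0 rs Dr.
  have after u : r < u <= s -> D 1 u < 0.
    move=> /andP[ru us]; rewrite ltNge; apply/negP => Du.
    have : u <= r.
      apply: sup_upper_bound => //; split => //.
      by rewrite us andbT (le_trans r0)// ltW.
    by rewrite leNgt ru.
  have lrs : l r = l s.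
    apply: (regulator_cst sy r0 rs) => u us bu; have := after u us.
    have [hp' _ _] := sy'; rewrite /D bu subr0 ltNge hp'//.
    by case/andP: us => ru _; rewrite (le_trans r0)// ltW.
  have [_ [_ lmono _ _] _] := sy'; have lrs' := lmono r s r0 rs.
  have e := solution_increment 1 cy sy r0 rs.
  have e' := solution_increment 1 cy' sy' r0 rs.
  rewrite inward_normal1 lrs in e e'.
  by move: Dr lrs' (intB _ _ r0 rs) e e'; rewrite /D; clear; lra.
have mz : forall s, 0 <= s -> m s = 0.
  apply: gronwall0 => // s s0.
  by rewrite mulr_natl mulr2n lerD// bound.
move=> s i s0; rewrite -subr_ge0 -/(D i s) -oppr_le0.
have : neg (D i s) = 0.
  have := mz s s0; rewrite /m => /eqP; rewrite paddr_eq0//.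
  case/andP => /eqP h0 /eqP h1.
  have [->//|i1] := eqVneq i 0.
  by rewrite (_ : i = 1)//; case: i i1 => [[|[|//]]] // ? _; exact: val_inj.
by move=> <-.
Qed.

End Reflected.

(** * Products of stretching factors over families of gaps *)

Section Stretch.
Context {R : realType}.
Implicit Types u v a b : R.

Lemma stretch0 : stretch (0 : R) = 1.
Proof. by rewrite /stretch mulr0 expR0; field. Qed.

Lemma stretch_le u v : u <= v -> stretch u <= stretch v.
Proof.
by move=> uv; rewrite /stretch ler_pM2r ?invr_gt0// lerD2r ler_expR ler_pM2l.
Qed.

Lemma stretch_ge1 u : 0 <= u -> 1 <= stretch u.
Proof. by move=> u0; rewrite -stretch0 stretch_le. Qed.

Lemma stretch_gt0 u : 0 < stretch u.
Proof. by rewrite divr_gt0// addr_gt0// expR_gt0. Qed.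

(** The defect in supermultiplicativity, which is positive for positive lengths. *)
Lemma stretchD u v : stretch (u + v) - stretch u * stretch v =
  (expR (2 * u) - 1) * (expR (2 * v) - 1) / 4.
Proof. by rewrite /stretch mulrDr expRD; field. Qed.

Lemma stretchM_le u v : 0 <= u -> 0 <= v ->
  stretch u * stretch v <= stretch (u + v).
Proof.
move=> u0 v0; rewrite -subr_ge0 stretchD divr_ge0// mulr_ge0// subr_ge0;
  by rewrite -expR0 ler_expR mulr_ge0.
Qed.

Lemma prod_stretch_ge1 (T : choiceType) (s : seq T) (Q : pred T) (g : T -> R) :
  (forall i, i \in s -> Q i -> 0 <= g i) ->
  1 <= \prod_(i <- s | Q i) stretch (g i).
Proof.
move=> g0; rewrite big_seq_cond.
elim/big_ind: _ => // [x y x1 y1|i /andP[si Qi]].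
  by rewrite -[leLHS]mulr1 ler_pM.
by rewrite stretch_ge1// g0.
Qed.

Lemma prod_stretch_le (T : choiceType) (s : seq T) (Q : pred T) (g : T -> R) :
  (forall i, i \in s -> Q i -> 0 <= g i) ->
  \prod_(i <- s | Q i) stretch (g i) <= stretch (\sum_(i <- s | Q i) g i).
Proof.
move=> g0; rewrite big_seq_cond [in leRHS]big_seq_cond.
suff : [/\ 0 <= \prod_(i <- s | (i \in s) && Q i) stretch (g i),
  \prod_(i <- s | (i \in s) && Q i) stretch (g i) <=
  stretch (\sum_(i <- s | (i \in s) && Q i) g i) &
  0 <= \sum_(i <- s | (i \in s) && Q i) g i] by case.
elim/big_ind2: _ => [|x y x' y' [x0 xy y0] [x0' xy' y0']|i /andP[si Qi]].
- by rewrite stretch0.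
- split; [exact: mulr_ge0| |exact: addr_ge0].
  by apply: le_trans (stretchM_le y0 y0'); exact: ler_pM.
- by split; [exact/ltW/stretch_gt0|exact: lexx|exact: g0].
Qed.

End Stretch.

Section Families.
Context {R : realType}.
Implicit Types (I J : R * R) (F : {fset (R * R)}) (Z : set R).

(** Disjointness of the open intervals encoded by [I] and [J]. *)
Definition separated I J := (I.2 <= J.1) || (J.2 <= I.1).

(** Cutting an interval into disjoint pieces decreases the product: the lengths of
    the pieces add up to at most [b - a]. *)
Lemma separated_prod_le F (Q : pred (R * R)) a b : a <= b ->
  (forall I, I \in F -> Q I -> [/\ a <= I.1, I.1 <= I.2 & I.2 <= b]) ->
  {in F &, forall I J, I != J -> separated I J} ->
  \prod_(I <- F | Q I) stretch (I.2 - I.1) <= stretch (b - a).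
Proof.
move=> ab Fab Fsep.
apply: le_trans (prod_stretch_le _) (stretch_le _).
  by move=> I IF QI; rewrite subr_ge0; case: (Fab I IF QI).
pose G I : set R := if Q I then `]I.1, I.2[%classic else set0.
have mG I : measurable (G I : set (measurableTypeR R)) by rewrite /G; case: ifP.
have tG : trivIset [set` F] G.
  move=> I J /= IF JF [u []]; rewrite /G; case: ifP => // _; case: ifP => // _.
  rewrite /= !in_itv/= => /andP[Iu uI] /andP[Ju uJ].
  apply: contrapT => /eqP /(Fsep _ _ IF JF) /orP[] h.
    by have := lt_trans uI (le_lt_trans h Ju); rewrite ltxx.
  by have := lt_trans uJ (le_lt_trans h Iu); rewrite ltxx.
rewrite -lee_fin.
have <- : (\sum_(I <- F) lebesgue_measure (G I))%E =
          (\sum_(I <- F | Q I) (I.2 - I.1))%:E.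
  rewrite -sumEFin [RHS]big_mkcond/= big_seq [RHS]big_seq.
  apply: eq_bigr => I IF; rewrite /G; case: ifPn => [QI|_]; last by rewrite measure0.
  rewrite lebesgue_measure_itv/= lte_fin; have [_ + _] := Fab I IF QI.
  by rewrite le_eqVlt => /predU1P[->|->]; rewrite ?ltxx ?subrr.
rewrite -measure_fbigsetU//.
have -> : (b - a)%:E = lebesgue_measure `[a, b]%classic.
  rewrite lebesgue_measure_itv/= lte_fin; move: ab; rewrite le_eqVlt.
  by move=> /predU1P[->|->]; rewrite ?ltxx ?subrr.
apply: le_measure; rewrite ?inE//.
  by apply: bigsetU_measurable => I _; exact: mG.
rewrite -bigcup_fset => u [I /= IF]; rewrite /G; case: ifPn => // QI.
have [aI _ Ib] := Fab I IF QI; rewrite /= !in_itv/= => /andP[Iu uI].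
by rewrite (le_trans aI (ltW Iu)) (le_trans (ltW uI) Ib).
Qed.

(** Finite families of disjoint open intervals of [[0, t]] which avoid [Z]; they
    need not be connected components of the complement of [Z]. *)
Definition gap_family (t : R) Z F : Prop :=
  (forall I, I \in F ->
     [/\ 0 <= I.1, I.1 < I.2, I.2 <= t & forall s, I.1 < s < I.2 -> ~ Z s]) /\
  {in F &, forall I J, I != J -> separated I J}.

(** The supremum of the products of stretching factors over such families; it is
    antitone in [Z]. *)
Definition gap_product (t : R) Z : R :=
  sup [set \prod_(I <- F) stretch (I.2 - I.1) | F in [set F | gap_family t Z F]].

Lemma gap_family_le t Z F : 0 <= t -> gap_family t Z F ->
  \prod_(I <- F) stretch (I.2 - I.1) <= stretch t.
Proof.
move=> t0 [HF sF]; rewrite -[in leRHS](subr0 t).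
apply: separated_prod_le => // I IF _; have [I0 I12 It _] := HF I IF.
by split => //; exact: ltW.
Qed.

Lemma gap_product_ge t Z F : 0 <= t -> gap_family t Z F ->
  \prod_(I <- F) stretch (I.2 - I.1) <= gap_product t Z.
Proof.
move=> t0 HF; apply: sup_upper_bound; last by exists F.
split; first by exists (\prod_(I <- F) stretch (I.2 - I.1)); exists F.
by exists (stretch t) => _ [G HG <-]; exact: gap_family_le HG.
Qed.

Lemma gap_product_le t Z (c : R) :
  (forall F, gap_family t Z F -> \prod_(I <- F) stretch (I.2 - I.1) <= c) ->
  gap_product t Z <= c.
Proof.
move=> H; apply: ge_sup => [|_ [F HF <-]]; last exact: H.
by exists (\prod_(I <- fset0) stretch (I.2 - I.1)); exists fset0.
Qed.

Lemma gap_product_anti t Z Z' : 0 <= t -> Z' `<=` Z ->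
  gap_product t Z <= gap_product t Z'.
Proof.
move=> t0 ZZ'; apply: gap_product_le => F [HF sF]; apply: gap_product_ge => //.
split => // I IF; have [? ? ? h] := HF I IF; split => // s sI /ZZ'.
exact: h.
Qed.

(** If [Z] contains a time [u] in [[c, a]] while [Z'] avoids [(0, s)], then the
    product for [Z'] is larger by an amount depending on [c] and [q - a] only. The
    pieces of a family that lie in [[0, s]] are replaced by the single interval
    [(0, s)]; since [u] splits them into two groups, this gains at least the
    defect given by [stretchD] for [u] and [s - u], and the product of the remaining
    factors is at least 1. *)
Lemma gap_product_gain t Z Z' u s c a q : 0 < c -> c <= u -> u <= a -> a < q ->
  q <= s -> s <= t -> Z' `<=` Z -> Z u -> (Z s \/ s = t) ->
  (forall r, 0 < r < s -> ~ Z' r) ->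
  gap_product t Z + (expR (2 * c) - 1) * (expR (2 * (q - a)) - 1) / 4 <=
  gap_product t Z'.
Proof.
move=> c0 cu ua aq qs st ZZ' Zu Zs Z's.
have u0 : 0 < u := lt_le_trans c0 cu.
have us : u < s := lt_le_trans (le_lt_trans ua aq) qs.
have s0 : 0 < s := lt_trans u0 us.
have t0 : 0 < t := lt_le_trans s0 st.
set eta := _ / 4.
have eta_le : eta <= stretch s - stretch u * stretch (s - u).
  rewrite -{1}(subrKC u s) stretchD ler_pM2r//; apply: ler_pM.
  - by rewrite subr_ge0 -expR0 ler_expR mulr_ge0// ltW.
  - by rewrite subr_ge0 -expR0 ler_expR mulr_ge0// subr_ge0 ltW.
  - by rewrite lerD2r ler_expR ler_pM2l.
  - by rewrite lerD2r ler_expR ler_pM2l// lerB.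
rewrite -lerBrDr; apply: gap_product_le => F [HF sF]; rewrite lerBrDr.
pose F2 := [fset I in F | s < I.2]%fset.
have F2P I : I \in F2 -> I \in F /\ s <= I.1.
  rewrite !inE/= => /andP[IF sI]; split => //.
  have [I0 I12 It h] := HF I IF.
  case: Zs => [Zs|st']; last by move: sI; rewrite st' ltNge It.
  by rewrite leNgt; apply/negP => Is; apply: (h s) => //; rewrite Is.
pose F' := ((0, s) |` F2)%fset.
have HF' : gap_family t Z' F'.
  split.
    move=> I; rewrite in_fset1U => /orP[/eqP -> //|/F2P[IF sI]].
    have [I0 I12 It h] := HF I IF; split => // r rI /ZZ'; exact: h.
  move=> I J; rewrite !in_fset1U.
  move=> /orP[/eqP ->|/F2P[IF sI]] /orP[/eqP ->|/F2P[JF sJ]].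
  - by rewrite eqxx.
  - by move=> _; rewrite /separated/= sJ.
  - by move=> _; rewrite /separated/= sI orbT.
  - exact: sF.
apply: le_trans (gap_product_ge (ltW t0) HF').
rewrite big_fsetU1/=; last first.
  by apply/negP => /F2P[_ /=]; rewrite leNgt s0.
rewrite subr0 (bigID (fun I => s < I.2))/=.
rewrite (_ : \prod_(I <- F2) _ = \prod_(I <- F | s < I.2) stretch (I.2 - I.1)); last first.
  by rewrite big_fset.
set A := \prod_(I <- F | _) _; set B := \prod_(I <- F | _) _.
have A1 : 1 <= A.
  apply: prod_stretch_ge1 => I IF _; rewrite subr_ge0.
  by have [_ /ltW] := HF I IF.
have B_le : B <= stretch u * stretch (s - u).
  rewrite /B (bigID (fun I => I.2 <= u))/=; apply: ler_pM.
  - by rewrite (le_trans ler01)// prod_stretch_ge1// => I IF _; rewrite subr_ge0; have [_ /ltW] := HF I IF.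
  - by rewrite (le_trans ler01)// prod_stretch_ge1// => I IF _; rewrite subr_ge0; have [_ /ltW] := HF I IF.
  - rewrite -[in leRHS](subr0 u); apply: separated_prod_le => //; first exact: ltW.
    by move=> I IF /andP[_ Iu]; have [I0 /ltW I12 _ _] := HF I IF.
  - apply: separated_prod_le => //; first exact: ltW.
    move=> I IF /andP[]; rewrite -leNgt -ltNge => Is uI.
    have [I0 /ltW I12 _ h] := HF I IF; split => //.
    by rewrite leNgt; apply/negP => Iu; apply: (h u) => //; rewrite Iu.
have : A * B <= A * (stretch s - eta).
  by rewrite ler_wpM2l ?(le_trans ler01)//; lra.
have eta0 : 0 < eta.
  by rewrite divr_gt0// mulr_gt0// subr_gt0 -expR0 ltr_expR mulr_gt0// subr_gt0.
by nra.
Qed.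

End Families.

(** * The flow factor as a supremum over families of gaps *)

Section FlowFactor.
Context {R : realType}.
Variable phi : R -> 'cV[R]_2 -> 'cV[R]_2.

(** The times at which the trajectory from [x] is on the boundary. *)
Definition zero_times (x : 'cV[R]_2) : set R :=
  [set s | 0 <= s /\ boundary (phi s x)].

Variable x : 'cV[R]_2.
Local Notation Z := (zero_times x).
Hypothesis closedZ : closed Z.

(** As soon as the boundary is hit, the hitting time is a minimum. *)
Lemma hitting_timeP z : Z z -> exists s, [/\ hitting_time phi x = s%:E, Z s,
  s <= z & forall r, Z r -> s <= r].
Proof.
move=> Zz; have iZ : has_inf Z by split; [exists z|exists 0 => r []].
have Zs := closed_inf_mem closedZ iZ; set s := inf Z in Zs *.
have sZ r : Z r -> s <= r by move=> Zr; apply: ge_inf => //; case: iZ.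
exists s; split => //; last exact: sZ.
apply/eqP; rewrite eq_le; apply/andP; split.
  by apply: ereal_inf_lbound; exists s.
by apply: le_ereal_inf_tmp => _ [r Zr <-]; rewrite lee_fin sZ.
Qed.

Lemma hitting_time_lt t : (hitting_time phi x < t%:E)%E ->
  exists2 z, Z z & z < t.
Proof.
by move=> /ereal_inf_lt[_ [z Zz <-]]; rewrite lte_fin; exists z.
Qed.

(** The last hitting time before [t] is a maximum. *)
Lemma last_hitP t z : Z z -> z <= t ->
  [/\ Z (last_hit phi t x), last_hit phi t x <= t &
      forall r, Z r -> r <= t -> r <= last_hit phi t x].
Proof.
move=> Zz zt; set A := [set s | 0 <= s <= t /\ boundary (phi s x)].
have AE : A = Z `&` [set s | s <= t].
  apply/seteqP; split => s /=; first by move=> [/andP[]].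
  by move=> [[? ?] ?]; split => //; apply/andP.
have sA : has_sup A.
  split; first by exists z; rewrite AE.
  by exists t => s; rewrite AE => -[].
have cA : closed A by rewrite AE; apply: closedI => //; exact: closed_le.
have := closed_sup_mem cA sA; rewrite {1}AE -/(last_hit phi t x) => -[Zl lt].
split => // r Zr rt; apply: sup_upper_bound => //.
by change (A r); rewrite AE.
Qed.

Variable t : R.
Hypotheses (t0 : 0 < t) (nZ0 : ~ Z 0) (nZt : ~ Z t).

(* [s] is the hitting time and [tau] the last hitting time before [t]. *)
Section Hit.
Variable s : R.
Hypotheses (sE : hitting_time phi x = s%:E) (Zs : Z s) (st : s <= t)
  (smin : forall r, Z r -> s <= r).
Let tau := last_hit phi t x.

Let Ztau : Z tau. Proof. by have [] := last_hitP Zs st. Qed.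
Let tau_le : tau <= t. Proof. by have [] := last_hitP Zs st. Qed.
Let tau_max r : Z r -> r <= t -> r <= tau.
Proof. by have [_ _] := last_hitP Zs st; exact. Qed.

Let s0 : 0 < s.
Proof.
rewrite lt_neqAle; have [-> _] := Zs; rewrite andbT.
by apply/eqP => s0; apply: nZ0; rewrite s0.
Qed.

Let taut : tau < t.
Proof.
by rewrite lt_neqAle tau_le andbT; apply/eqP => e; apply: nZt; rewrite -e.
Qed.

Let stau : s <= tau. Proof. exact: tau_max. Qed.

Lemma off_boundaryE r : off_boundary phi x r <-> s < r /\ ~ Z r.
Proof.
rewrite /off_boundary/= sE lte_fin; split => -[sr nb]; split => //.
  by move=> [].
by move=> b; apply: nb; split => //; rewrite (le_trans (ltW s0))// ltW.
Qed.

(** Past excursions lie between the first and the last hitting time: beyond [tau],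
    the component contains [t], so it is not over before [t]. *)
Lemma past_excursionP I : past_excursions phi t x I ->
  [/\ s <= I.1, I.1 < I.2, I.2 <= tau & forall r, I.1 < r < I.2 ->
    ~ Z r /\ connected_component (off_boundary phi x) r = `]I.1, I.2[%classic].
Proof.
move=> [[m offm CE] It].
have Cm : `]I.1, I.2[%classic m by rewrite -CE; exact: connected_component_refl.
have I12 : I.1 < I.2 by move: Cm; rewrite /= in_itv/= => /andP[]; exact: lt_trans.
have inI r : I.1 < r < I.2 ->
    connected_component (off_boundary phi x) r = `]I.1, I.2[%classic.
  move=> rI; rewrite -CE; apply/esym/same_connected_component.
  by rewrite CE /= in_itv.
have offI r : I.1 < r < I.2 -> off_boundary phi x r.
  move=> rI; apply: (@connected_component_sub _ _ m).
  by rewrite CE /= in_itv.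
have I2t : I.2 < t.
  have : `]0, t[%classic I.2 by apply: It; rewrite /= in_itv/= lexx andbT ltW.
  by rewrite /= in_itv/= => /andP[].
split => //.
- rewrite leNgt; apply/negP => Is.
  pose r := (I.1 + Num.min s I.2) / 2.
  have /andP[r1 r2] : I.1 < r < Num.min s I.2 by rewrite !midf_lt// lt_min Is.
  move: r2; rewrite lt_min => /andP[rs r2].
  have /off_boundaryE[] : off_boundary phi x r by apply: offI; rewrite r1.
  by rewrite ltNge ltW.
- rewrite leNgt; apply/negP => tauI.
  pose r := (Num.max tau I.1 + I.2) / 2.
  have /andP[r1 r2] : Num.max tau I.1 < r < I.2 by rewrite !midf_lt// gt_max tauI.
  move: r1; rewrite gt_max => /andP[taur r1].
  have rI : I.1 < r < I.2 by rewrite r1.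
  suff : connected_component (off_boundary phi x) r t.
    by rewrite (inI _ rI) /= in_itv/= => /andP[_ /(lt_trans I2t)]; rewrite ltxx.
  have : `[r, t] `<=` connected_component (off_boundary phi x) r.
    apply: connected_component_max; first by rewrite /= in_itv/= lexx (ltW (lt_trans r2 I2t)).
    + move=> v; rewrite /= in_itv/= => /andP[rv vt]; apply/off_boundaryE.
      have tauv : tau < v := lt_le_trans taur rv.
      split; first exact: le_lt_trans tauv.
      by move=> Zv; have := tau_max Zv vt; rewrite leNgt tauv.
    + by apply/connected_intervalP; exact: interval_is_interval.
  by apply; rewrite /= in_itv/= lexx (ltW (lt_trans r2 I2t)).
- move=> r rI; split; last exact: inI.
  by have /off_boundaryE[] := offI _ rI.
Qed.

Lemma past_excursions_separated I J : past_excursions phi t x I ->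
  past_excursions phi t x J -> I != J -> separated I J.
Proof.
move=> /past_excursionP[_ I12 _ hI] /past_excursionP[_ J12 _ hJ].
apply: contraNT; rewrite /separated negb_or -!ltNge => /andP[JI IJ].
pose r := (Num.max I.1 J.1 + Num.min I.2 J.2) / 2.
have /andP[] : Num.max I.1 J.1 < r < Num.min I.2 J.2.
  by rewrite !midf_lt// gt_max !lt_min I12 IJ JI.
rewrite gt_max lt_min => /andP[r1 r2] /andP[r3 r4].
have [_ EI] := hI r (introT andP (conj r1 r3)).
have [_ EJ] := hJ r (introT andP (conj r2 r4)).
have [] : I.1 = J.1 /\ I.2 = J.2 by apply: itvoo_inj; rewrite -?EI.
by case: I J {I12 hI J12 hJ JI IJ r r1 r2 r3 r4 EI EJ} => [? ?] [? ?] /= -> ->.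
Qed.

(** The endpoints are the last zero before [a] and the first one after [b]. *)
Lemma past_excursion_cover a b : s <= a -> a < b -> b <= tau ->
  (forall r, a < r < b -> ~ Z r) ->
  exists I, [/\ past_excursions phi t x I, I.1 <= a & b <= I.2].
Proof.
move=> sa ab btau nab.
pose m := (a + b) / 2; have /andP[am mb] : a < m < b by rewrite !midf_lt.
pose A := Z `&` [set r | r <= a]; pose B := Z `&` [set r | b <= r].
have sA : has_sup A by split; [exists s|exists a => r []].
have iB : has_inf B by split; [exists tau|exists b => r []].
have [Zl la] := closed_sup_mem (closedI closedZ (@closed_le _ a)) sA.
have [Zr br] := closed_inf_mem (closedI closedZ (@closed_ge _ b)) iB.
rewrite -/A -/B in Zl la Zr br.
set l := sup A in Zl la; set r := inf B in Zr br.
have nlr v : l < v < r -> ~ Z v.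
  move=> /andP[lv vr] Zv.
  have [va|av] := leP v a.
    have : v <= l by apply: sup_upper_bound.
    by rewrite leNgt lv.
  have [bv|vb] := leP b v.
    have : r <= v by apply: ge_inf; [case: iB|].
    by rewrite leNgt vr.
  by apply: (nab v) => //; rewrite av.
have sl : s <= l by apply: sup_upper_bound.
have rtau : r <= tau by apply: ge_inf; [case: iB|].
exists (l, r); split => //; split => /=.
  have lmr : l < m < r by rewrite (le_lt_trans la am) (lt_le_trans mb br).
  exists m.
    apply/off_boundaryE; split; first by case/andP: lmr => /(le_lt_trans sl).
    exact: nlr.
  apply: component_itvoo => //.
  - move=> v; rewrite /= in_itv/= => vlr; apply/off_boundaryE; split.
      by case/andP: vlr => /(le_lt_trans sl).
    exact: nlr.
  - by move=> /off_boundaryE[].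
  - by move=> /off_boundaryE[].
move=> v; rewrite /= !in_itv/= => /andP[lv vr].
by rewrite (lt_le_trans s0 (le_trans sl lv)) (le_lt_trans (le_trans vr rtau) taut).
Qed.

Local Notation past := (past_excursions phi t x).
Local Notation len := (fun I : R * R => stretch (I.2 - I.1)).

(** The initial interval [(0, s)] and the final interval [(tau, t)] complete a
    family of past excursions into a family of gaps. *)
Lemma past_family F : [set` F] `<=` past ->
  gap_family t Z ((0%R, s) |` ((tau, t) |` F))%fset /\
  \prod_(I <- ((0%R, s) |` ((tau, t) |` F))%fset) len I =
  stretch (t - tau) * stretch s * \prod_(I <- F) len I.
Proof.
move=> Fpast; have FP I : I \in F -> past I by move=> IF; exact: Fpast.
split; last first.
  rewrite big_fsetU1/=; last first.
    rewrite in_fset1U negb_or; apply/andP; split.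
      by apply/eqP => -[e _]; move: stau; rewrite -e leNgt s0.
    by apply/negP => /FP/past_excursionP[/=]; rewrite leNgt s0.
  rewrite big_fsetU1/=; last first.
    by apply/negP => /FP/past_excursionP[/= _ _]; rewrite leNgt taut.
  by rewrite subr0; ring.
split.
  move=> I; rewrite !in_fset1U => /orP[/eqP ->|/orP[/eqP ->|/FP/past_excursionP]] /=.
  - by split => // r /andP[_ rs] /smin; rewrite leNgt rs.
  - split => //; first by case: Ztau.
    by move=> r /andP[taur rt] Zr; have := tau_max Zr (ltW rt); rewrite leNgt taur.
  - move=> [sI I12 Itau h]; split => //.
    + exact: le_trans (ltW s0) sI.
    + exact: le_trans Itau tau_le.
    + by move=> r /h[].
move=> I J; rewrite !in_fset1U /separated.
move=> /orP[/eqP ->|/orP[/eqP ->|IF]] /orP[/eqP ->|/orP[/eqP ->|JF]] //=; rewrite ?eqxx//.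
- by rewrite stau.
- by have /past_excursionP[-> _ _ _] := FP _ JF.
- by rewrite stau orbT.
- by have /past_excursionP[_ _ -> _] := FP _ JF; rewrite orbT.
- by have /past_excursionP[-> _ _ _] := FP _ IF; rewrite orbT.
- by have /past_excursionP[_ _ -> _] := FP _ IF.
- by apply: past_excursions_separated; exact: FP.
Qed.

Let cpos : 0 < stretch (t - tau) * stretch s.
Proof. by rewrite mulr_gt0// stretch_gt0. Qed.

Lemma prod_past_ub : has_ubound
  [set \prod_(k <- F) len k | F in [set F : {fset (R * R)} | [set` F] `<=` past]].
Proof.
exists (gap_product t Z / (stretch (t - tau) * stretch s)) => _ [F Fpast <-].
have [famF E] := past_family Fpast.
rewrite ler_pdivlMr// mulrC -E; apply: gap_product_ge => //; exact: ltW.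
Qed.

(** An arbitrary family of gaps is grouped according to the gap of the complement
    of [Z] (initial, final, or past excursion) which contains each interval. *)
Lemma flow_factor_hit : stretch (t - tau) * stretch s * prod_ge1 past len =
  gap_product t Z.
Proof.
apply/eqP; rewrite eq_le; apply/andP; split.
  rewrite mulrC -ler_pdivlMr//; apply: ge_sup.
    by exists (\prod_(k <- fset0) len k); exists fset0 => //= I.
  move=> _ [F Fpast <-]; have [famF E] := past_family Fpast.
  by rewrite ler_pdivlMr// mulrC -E; apply: gap_product_ge => //; exact: ltW.
apply: gap_product_le => F [HF sF].
have len0 I : I \in F -> 0 <= I.2 - I.1.
  by move=> IF; rewrite subr_ge0; have [_ /ltW] := HF I IF.
have prod0 Q : 0 <= \prod_(I <- F | Q I) len I.
  by rewrite (le_trans ler01)// prod_stretch_ge1// => I IF _; exact: len0.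
rewrite (bigID (fun I => I.2 <= s))/=.
rewrite [X in _ * X](bigID (fun I => tau <= I.1))/= mulrA.
apply: ler_pM => //; first exact: mulr_ge0.
  rewrite mulrC; apply: ler_pM => //.
  - apply: separated_prod_le => // I IF /andP[_ tI].
    by have [_ /ltW ? ? _] := HF I IF.
  - rewrite -[in leRHS](subr0 s); apply: separated_prod_le => //; first exact: ltW.
    by move=> I IF Is; have [? /ltW ? _ _] := HF I IF.
pose F2 := [fset I in F | ~~ (I.2 <= s) && ~~ (tau <= I.1)]%fset.
have -> : \prod_(I <- F | ~~ (I.2 <= s) && ~~ (tau <= I.1)) len I =
    \prod_(I <- F2) len I by rewrite big_fset.
have cover I : exists J, I \in F2 -> [/\ past J, J.1 <= I.1 & I.2 <= J.2].
  have [|_] := boolP (I \in F2); last by exists I.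
  rewrite !inE/= -!ltNge => /andP[IF /andP[sI Itau]].
  have [I0 I12 It h] := HF I IF.
  have [||J HJ] := @past_excursion_cover I.1 I.2 _ I12 _ h; last by exists J.
    by rewrite leNgt; apply/negP => Is; apply: (h s) => //; rewrite Is.
  by rewrite leNgt; apply/negP => Is; apply: (h tau) => //; rewrite Itau.
have [f Hf] := choice cover.
have sub2 I : I \in F2 -> I \in F by rewrite !inE => /andP[].
rewrite (partition_big_imfset _ f)/=.
apply: (@le_trans _ _ (\prod_(J <- [fset f I | I in F2]%fset) len J)).
  rewrite big_seq [leRHS]big_seq; apply: ler_prod => J /imfsetP[I0 /= I0F JE].
  apply/andP; split.
    rewrite (le_trans ler01)// prod_stretch_ge1// => I IF _; exact/len0/sub2.
  have [/past_excursionP[_ J12 _ _] _ _] := Hf _ I0F; rewrite -JE in J12.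
  apply: separated_prod_le; first exact: ltW.
    move=> I IF /eqP fI; have [_ h1 h2] := Hf _ IF; rewrite fI in h1 h2.
    by have [_ /ltW] := HF I (sub2 _ IF).
  by move=> I K IF KF; apply: sF; exact: sub2.
apply: sup_upper_bound.
  split; last exact: prod_past_ub.
  by exists (\prod_(k <- fset0) len k); exists fset0 => //= I.
exists [fset f I | I in F2]%fset => //= J /imfsetP[I /= IF ->].
by have [] := Hf _ IF.
Qed.

End Hit.

(** The hypothesis [nZt] matters: an excursion ending exactly at [t] contributes to
    [gap_product] but not to [flow_factor]. *)
Lemma flow_factorE : flow_factor phi t x = gap_product t Z.
Proof.
have t0' := ltW t0; rewrite /flow_factor; case: ltP => ht.
  apply/eqP; rewrite eq_le; apply/andP; split; last first.
    by apply: gap_product_le => F; exact: gap_family_le.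
  have -> : stretch t = \prod_(I <- [fset (0%R, t)]%fset) stretch (I.2 - I.1).
    by rewrite big_seq_fset1 subr0.
  apply: gap_product_ge => //; split.
    move=> I; rewrite in_fset1 => /eqP -> /=; split => // r /andP[r0 rt] Zr.
    have : (hitting_time phi x <= r%:E)%E by apply: ereal_inf_lbound; exists r.
    by move=> /(lt_le_trans ht); rewrite lte_fin ltNge ltW.
  by move=> I J; rewrite !in_fset1 => /eqP -> /eqP ->; rewrite eqxx.
have [z Zz] : exists z, Z z.
  apply: contrapT => nZ; have : ((t + 1)%:E <= hitting_time phi x)%E.
    by apply: le_ereal_inf_tmp => _ [r Zr <-]; case: nZ; exists r.
  by move=> /le_trans/(_ ht); rewrite lee_fin; lra.
have [s [sE Zs _ smin]] := hitting_timeP Zz.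
rewrite -(flow_factor_hit sE Zs _ smin)//; last by move: ht; rewrite sE lee_fin.
by rewrite sE.
Qed.

End FlowFactor.

(** * Monotonicity and jumps along a fixed noise path *)

(** A monotone function has one-sided limits. *)
Lemma jump_of_gap (R : realType) (g : R -> R) (m a eta : R) :
  {homo g : x y / x <= y} -> m < a -> 0 < eta ->
  (forall z z', m < z < a -> a < z' -> g z + eta <= g z') ->
  jump_discontinuity g a.
Proof.
move=> gm ma eta0 gap.
have cl : cvg (g z @[z --> a^'-]).
  apply: nondecreasing_at_left_is_cvgr.
    by apply: nearW => x u v _ _; exact: gm.
  apply: nearW => x; exists (g a) => _ [u /= + <-].
  by rewrite in_itv/= => /andP[_ /ltW]; exact: gm.
have cr : cvg (g z @[z --> a^'+]).
  apply: nondecreasing_at_right_is_cvgr.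
    by apply: nearW => x u v _ _; exact: gm.
  apply: nearW => x; exists (g a) => _ [u /= + <-].
  by rewrite in_itv/= => /andP[/ltW + _]; exact: gm.
exists (lim (g z @[z --> a^'-])), (lim (g z @[z --> a^'+])); split => //.
suff H : lim (g z @[z --> a^'-]) <= lim (g z @[z --> a^'+]) - eta.
  by rewrite lt_eqF// (le_lt_trans H)// gtrBl.
apply: limr_le => //; near=> z; rewrite lerBrDr.
apply: limr_ge => //; near=> z'.
apply: gap; last by near: z'; exact: nbhs_right_gt.
by apply/andP; split; near: z; [exact: nbhs_left_gt|exact: nbhs_left_lt].
Unshelve. all: by end_near. Qed.

Section Path.
Context {R : realType}.
Variables (W : R -> 'cV[R]_2) (phi : R -> 'cV[R]_2 -> 'cV[R]_2)
  (L : R -> 'cV[R]_2 -> R).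
Hypotheses (W0 : W 0 = 0) (hphi : reflecting_flow W phi L).

Lemma vec2_0 (a b : R) : vec2 a b 0 0 = a. Proof. by rewrite mxE. Qed.

Lemma vec2_1 (a b : R) : vec2 a b 1 0 = b. Proof. by rewrite mxE. Qed.

Lemma continuous_vec2 (b : R) : continuous (fun z : R => vec2 z b).
Proof.
move=> z; rewrite (_ : (fun z => vec2 z b) = (fun z => vec2 0 b + z *: vec2 1 0)).
  have c1 : (fun u : R => u) @ z --> z by exact: cvg_id.
  have c2 := cvgZr_tmp (a := (vec2 1 0 : 'cV[R]_2)) c1.
  apply: cvgD; [exact: cvg_cst|exact: c2].
apply/funext => u; apply/matrixP => i j; rewrite !mxE.
by case: i => [[|[|//]]] ? /=; rewrite ?mulr1 ?mulr0 ?add0r ?addr0.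
Qed.

Lemma half_plane_vec2 (a b : R) : 0 < b -> half_plane (vec2 a b).
Proof. by move=> b0; rewrite /half_plane/= vec2_1 ltW. Qed.

Lemma flow_continuous_time x : half_plane x ->
  {within `[0, +oo[, continuous (phi^~ x)}.
Proof.
move=> hx; have [/subspace_continuousP cphi _] := hphi.
apply/subspace_continuousP => s; rewrite /= in_itv/= andbT => s0.
have cs := cphi (s, x) (conj s0 hx).
apply: (cvg_comp (fun r : R => (r, x)) (fun p => phi p.1 p.2) _ cs).
move=> B wB.
have : \forall r \near s, (0 <= r /\ half_plane x) -> B (r, x).
  have c1 : (fun r : R => r) @ s --> s by exact: cvg_id.
  have c2 : (fun _ : R => x) @ s --> x by exact: cvg_cst.
  exact: (cvg_pair c1 c2 wB).
by apply: filterS => r Hr; rewrite /= in_itv/= andbT => r0; apply: Hr.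
Qed.

Lemma flow_half_plane s x : half_plane x -> 0 <= s -> half_plane (phi s x).
Proof. by move=> /hphi.2[+ _ _]; exact. Qed.

Lemma flow0 x : half_plane x -> phi 0 x 1 0 = x 1 0.
Proof.
move=> /hphi.2[_ [_ _ l0 _] ->//].
by rewrite l0 W0 set_itv1 Rintegral_set1 mxE mulr0 !addr0.
Qed.

Lemma closed_zero_times x : half_plane x -> closed (zero_times phi x).
Proof.
move=> hx; have cphi := continuous_coord (i := 1) (flow_continuous_time hx).
rewrite (_ : zero_times phi x = [set s | 0 <= s] `&`
    (fun s => phi (Num.max s 0) x 1 0) @^-1` [set r | r <= 0]).
  apply: closedI; first exact: closed_ge.
  apply: preimage_closed; last exact: closed_le.
  by move=> u _; exact: (continuous_halfline_ext cphi).
apply/seteqP; split => s /= [s0]; rewrite /boundary/= max_l//; first by move=> ->.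
move=> h; split => //; apply/eqP; rewrite eq_le h /=.
exact: flow_half_plane.
Qed.

Lemma zero_times0 x : half_plane x -> 0 < x 1 0 -> ~ zero_times phi x 0.
Proof.
by move=> hx x0 [_]; rewrite /boundary/= flow0// => e; move: x0; rewrite e ltxx.
Qed.

Lemma flow_le x x' : half_plane x -> half_plane x' ->
  (forall i, x i 0 <= x' i 0) ->
  forall s i, 0 <= s -> phi s x i 0 <= phi s x' i 0.
Proof.
move=> hx hx' xx' s i s0.
exact: (comparison (flow_continuous_time hx) (flow_continuous_time hx')
  (hphi.2 _ hx) (hphi.2 _ hx') xx' i s0).
Qed.

Lemma zero_times_subset x x' : half_plane x -> half_plane x' ->
  (forall i, x i 0 <= x' i 0) -> zero_times phi x' `<=` zero_times phi x.
Proof.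
move=> hx hx' xx' s [s0 b]; split => //; rewrite /boundary/=.
apply/eqP; rewrite eq_le; apply/andP; split; last exact: flow_half_plane.
by rewrite -b; exact: flow_le.
Qed.

(** Until the trajectory from [x] hits the boundary its regulator vanishes, and the
    first coordinates keep a gap of at least [e := x' 0 0 - x 0 0], which makes the
    difference of the second ones grow at rate at least [e]. *)
Lemma flow_before_hit_lt x x' s : half_plane x -> half_plane x' ->
  x 0 0 < x' 0 0 -> x 1 0 <= x' 1 0 -> 0 < s ->
  (forall r, zero_times phi x r -> s <= r) -> phi s x 1 0 < phi s x' 1 0.
Proof.
move=> hx hx' x0 x1 s0 nz.
have xx' i : x i 0 <= x' i 0.
  have [->|i1] := eqVneq i 0; first exact: ltW.
  by rewrite (_ : i = 1)//; case: i i1 => [[|[|//]]] // ? _; exact: val_inj.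
have cy := flow_continuous_time hx; have cy' := flow_continuous_time hx'.
have sy := hphi.2 _ hx; have sy' := hphi.2 _ hx'.
have [_ [cl _ l0 _] eqy] := sy; have [_ [_ lm' l0' _] eqy'] := sy'.
have Lz r : 0 <= r -> r < s -> L r x = 0.
  move=> r0 rs; rewrite -l0; apply/esym/(regulator_cst sy (lexx 0) r0).
  move=> u /andP[u0 ur] bu; have := nz u (conj (ltW u0) bu).
  by rewrite leNgt (le_lt_trans ur rs).
have Ls : L s x = 0.
  have : closed ((fun u => L (Num.max u 0) x) @^-1` [set z | z = 0]).
    apply: preimage_closed; last exact: closed_eq.
    by move=> u _; exact: (continuous_halfline_ext cl).
  have sub : `[0, s[ `<=` (fun u => L (Num.max u 0) x) @^-1` [set z | z = 0].
    by move=> u; rewrite /= in_itv/= => /andP[u0 us]; rewrite max_l// Lz.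
  move=> cE; have := cE s; rewrite /= max_l ?(ltW s0)//; apply.
  apply: (closure_subset sub).
  have E : sup `[0, s[%classic = s by rewrite sup_itv// bnd_simp.
  rewrite -[X in closure _ X]E.
  apply: closure_sup; first by exists 0; rewrite /= in_itv/= lexx.
  by exists s => u; rewrite /= in_itv/= => /andP[_ /ltW].
pose D i r := phi r x' i 0 - phi r x i 0.
have Dge i r : 0 <= r -> 0 <= D i r.
  by move=> r0; rewrite subr_ge0; exact: flow_le.
have cb := continuous_drift cy; have cb' := continuous_drift cy'.
have intE r : 0 <= r -> \int[lebesgue_measure]_(u in `]0, r])
     (phi u x' 0 0 + phi u x' 1 0) - \int[lebesgue_measure]_(u in `]0, r])
     (phi u x 0 0 + phi u x 1 0) =
   \int[lebesgue_measure]_(u in `]0, r]) (D 0 u + D 1 u).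
  move=> r0; have sub : `]0, r]%classic `<=` `[0, r].
    by move=> z /=; rewrite !in_itv/= => /andP[/ltW -> ->].
  rewrite -RintegralB//; last 2 first.
  - exact: (halfline_integrable cb' _ sub).
  - exact: (halfline_integrable cb _ sub).
  by apply: eq_Rintegral => u _; rewrite /D; ring.
have cD : {within `[0, +oo[, continuous (fun u => D 0 u + D 1 u)}.
  have cDi i : {within `[0, +oo[, continuous (D i)}.
    move=> u; have c' := @continuous_coord R (phi^~ x') i cy' u.
    have c := @continuous_coord R (phi^~ x) i cy u.
    exact: (cvgB c' c).
  by move=> u; exact: (cvgD (cDi 0 u) (cDi 1 u)).
pose e := x' 0 0 - x 0 0; have e0 : 0 < e by rewrite subr_gt0.
have D0e r : 0 <= r -> e <= D 0 r.
  move=> r0.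
  have i1 := solution_increment 0 cy sy (lexx 0) r0.
  have i2 := solution_increment 0 cy' sy' (lexx 0) r0.
  rewrite inward_normal0 in i1 i2.
  have i3 : 0 <= \int[lebesgue_measure]_(u in `]0, r]) (D 0 u + D 1 u).
    apply: Rintegral_ge0 => u; rewrite /= in_itv/= => /andP[/ltW u0 _].
    by rewrite addr_ge0// Dge.
  have i4 : phi 0 x 0 0 = x 0 0.
    by rewrite eqy// l0 W0 set_itv1 Rintegral_set1 mxE mulr0 !addr0.
  have i5 : phi 0 x' 0 0 = x' 0 0.
    by rewrite eqy'// l0' W0 set_itv1 Rintegral_set1 mxE mulr0 !addr0.
  rewrite i4 in i1; rewrite i5 in i2.
  by move: i1 i2 i3; rewrite -intE// /D /e; clear; lra.
have i1 := solution_increment 1 cy sy (lexx 0) (ltW s0).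
have i2 := solution_increment 1 cy' sy' (lexx 0) (ltW s0).
rewrite inward_normal1 l0 Ls in i1; rewrite inward_normal1 l0' in i2.
have i3 := lm' 0 s (lexx 0) (ltW s0); rewrite l0' in i3.
rewrite !flow0// in i1 i2.
have i4 : e * s <= \int[lebesgue_measure]_(u in `]0, s]) (D 0 u + D 1 u).
  rewrite -[s in e * s]subr0 -Rintegral_cst_itv ?(ltW s0)//.
  apply: halfline_le_Rintegral => //; last 2 first.
  - exact: ltW.
  - move=> u /andP[/ltW u0 _]; rewrite -[e]addr0 lerD ?D0e ?Dge//.
  by move=> u; exact: cvg_cst.
have es0 : 0 < e * s by rewrite mulr_gt0.
rewrite -(intE _ (ltW s0)) in i4.
by move: i1 i2 i3 i4 es0 x1; clear; lra.
Qed.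

Variable t : R.
Hypothesis t0 : 0 < t.
Hypothesis noq : forall (r : rat) x, 0 < ratr r :> R -> half_plane x ->
  ~ boundary (phi (ratr r) x).
Hypothesis not_ : forall x, half_plane x -> ~ boundary (phi t x).

Lemma flow_factor_gap x : half_plane x -> 0 < x 1 0 ->
  flow_factor phi t x = gap_product t (zero_times phi x).
Proof.
move=> hx x0; apply: flow_factorE => //.
- exact: closed_zero_times.
- exact: zero_times0.
- by move=> [_]; exact: not_.
Qed.

Lemma vec2_le (a b x2 : R) : a <= b ->
  forall i, vec2 a x2 i 0 <= vec2 b x2 i 0.
Proof. by move=> ab i; rewrite !mxE; case: i => [[|[|//]]]. Qed.

Lemma flow_factor_le x2 a b : 0 < x2 -> a <= b ->
  flow_factor phi t (vec2 a x2) <= flow_factor phi t (vec2 b x2).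
Proof.
move=> x20 ab; have hp z := half_plane_vec2 z x20.
rewrite !flow_factor_gap ?vec2_1//; apply: gap_product_anti; first exact: ltW.
by apply: zero_times_subset => //; exact: vec2_le.
Qed.

(** By joint continuity of the flow in time and starting point. *)
Lemma no_boundary_near x2 q z : 0 < x2 -> 0 < q -> ~ boundary (phi q (vec2 z x2)) ->
  exists2 e, 0 < e & forall s u, 0 <= s -> `|q - s| < e -> `|z - u| < e ->
    ~ boundary (phi s (vec2 u x2)).
Proof.
move=> x20 q0 nb; have hp u := half_plane_vec2 u x20.
have [/subspace_continuousP cphi _] := hphi.
pose S := [set M : 'cV[R]_2 | M 1 0 != 0].
have nS : nbhs (phi q (vec2 z x2)) S.
  have : (fun M : 'cV[R]_2 => M 1 0) M @[M --> phi q (vec2 z x2)] --> phi q (vec2 z x2) 1 0.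
    exact: coord_continuous.
  move=> /cvgr_neq0; apply.
  by apply/eqP.
have c2 : ((p.1 : R), vec2 p.2 x2) @[p --> (q, z)] --> (q, vec2 z x2).
  have c1 : (fun p : R * R => p.1) @ (q, z) --> q by exact: cvg_fst.
  have c2 : (fun p : R * R => vec2 p.2 x2) @ (q, z) --> vec2 z x2.
    apply: (cvg_comp (fun p : R * R => p.2) (fun u => vec2 u x2)).
      exact: cvg_snd.
    exact: continuous_vec2.
  exact: (cvg_pair c1 c2).
have := cphi (q, vec2 z x2) (conj (ltW q0) (hp z)) S nS.
move=> /(c2 _)/nbhs_ballP[e /= e0 He]; exists e => // s u s0 qs zu.
have Su : S (phi s (vec2 u x2)).
  by apply: (He (s, u)); split => //; exact: hp.
by move: Su => /eqP.
Qed.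

Lemma flow_factor_jump x1 x2 delta : 0 < x2 -> 0 < delta ->
  (hitting_time phi (vec2 x1 x2) < t%:E)%E ->
  exists2 a, a \in `]x1 - delta, x1 + delta[ &
    jump_discontinuity (fun z => flow_factor phi t (vec2 z x2)) a.
Proof.
move=> x20 d0 /hitting_time_lt[h1 Zh1 h1t].
have hp u := half_plane_vec2 u x20.
pose Z u := zero_times phi (vec2 u x2).
have ZS u v : u <= v -> Z v `<=` Z u.
  by move=> uv; apply: zero_times_subset => //; exact: vec2_le.
have hitP u r : Z u r -> exists s, [/\ Z u s, s <= r & forall v, Z u v -> s <= v].
  move=> /(hitting_timeP (closed_zero_times (hp u)))[s [_ ? ? ?]].
  by exists s.
have Zgt0 u r : Z u r -> 0 < r.
  move=> Zr; rewrite lt_neqAle; have [-> _] := Zr; rewrite andbT; apply/eqP => r0.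
  by move: Zr; rewrite -r0; apply: zero_times0 => //; rewrite vec2_1.
have [s1 [Zs1 s1h s1min]] := hitP _ _ Zh1.
pose z0 := x1 - delta / 2; pose zc := x1 - 3 * delta / 4.
have z0x : z0 < x1 by rewrite /z0; lra.
have zcz : zc < z0 by rewrite /z0 /zc; lra.
have [s0 [Zs0 s01 s0min]] := hitP _ _ (ZS _ _ (ltW z0x) _ Zs1).
have [c [Zc cs0 cmin]] := hitP _ _ (ZS _ _ (ltW zcz) _ Zs0).
have lt01 : s0 < s1.
  rewrite lt_neqAle s01 andbT; apply/eqP => e01.
  have := @flow_before_hit_lt (vec2 z0 x2) (vec2 x1 x2) s0 (hp _) (hp _) _ _ (Zgt0 _ _ Zs0) s0min.
  rewrite !vec2_0 !vec2_1 => /(_ z0x (lexx _)).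
  by rewrite {2}e01; have [_ ->] := Zs0; have [_ ->] := Zs1; rewrite ltxx.
have [r] := rat_in_itvoo lt01; rewrite in_itv/=; set q : R := ratr r => /andP[s0q qs1].
have q0 : 0 < q := lt_trans (Zgt0 _ _ Zs0) s0q.
have nq u : ~ Z u q by move=> [_]; exact: noq.
(* The hitting time crosses [q] at the supremum [a] of [E]. *)
pose E := [set u | u <= x1 /\ exists2 s, Z u s & s < q].
have Ez0 : E z0 by split; [exact: ltW|exists s0].
have sE : has_sup E by split; [exists z0|exists x1 => u []].
pose a := sup E.
have z0a : z0 <= a by apply: sup_upper_bound.
have ax1 : a <= x1 by apply: ge_sup => [|u []]; first by exists z0.
have left_hit u : u < a -> exists2 s, Z u s & s < q.
  move=> ua; have au0 : 0 < a - u by rewrite subr_gt0.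
  have [v [vx [s Zs sq]]] := sup_adherent au0 sE.
  by rewrite -/a subKr => /ltW uv; exists s => //; exact: ZS Zs.
have right_hit u s : a < u -> Z u s -> q < s.
  move=> au Zs; rewrite lt_neqAle; apply/andP; split.
    by apply/eqP => qs; apply: (nq u); rewrite qs.
  rewrite leNgt; apply/negP => sq.
  have [ux|xu] := leP u x1.
    have : u <= a by apply: sup_upper_bound => //; split => //; exists s.
    by rewrite leNgt au.
  have := s1min _ (ZS _ _ (ltW xu) _ Zs).
  by rewrite leNgt (lt_trans sq qs1).
have [e e0 He] := @no_boundary_near x2 q a x20 q0 (noq q0 (hp a)).
exists a.
  rewrite in_itv/= (le_lt_trans ax1) ?ltrDl// andbT (lt_le_trans _ z0a)//.
  by rewrite /z0; lra.
apply: (@jump_of_gap _ _ (Num.max zc (a - e)) a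
  ((expR (2 * c) - 1) * (expR (2 * (q - (q - e))) - 1) / 4)).
- by move=> u v; exact: flow_factor_le.
- by rewrite gt_max (lt_le_trans zcz z0a)/= gtrBl.
- have c0 := Zgt0 _ _ Zc; rewrite subKr divr_gt0// mulr_gt0// subr_gt0 -expR0 ltr_expR mulr_gt0//.
move=> z z' /andP[]; rewrite gt_max => /andP[zcz' az] za az'.
have [sz Zsz szq] := left_hit z za.
have [u [Zu usz umin]] := hitP _ _ Zsz.
have uq : u <= q - e.
  rewrite lerBrDr leNgt; apply/negP => que.
  have [u_ge0 bu] := Zu.
  apply: (He u z u_ge0 _ _ bu).
    by rewrite ger0_norm ?ltrBlDl// subr_ge0 (le_trans usz)// ltW.
  by rewrite ger0_norm ?subr_ge0 ?(ltW za)// ltrBlDl -ltrBlDr.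
rewrite !flow_factor_gap ?vec2_1//.
have zz' := lt_trans za az'.
have qt : q < t := lt_trans qs1 (le_lt_trans s1h h1t).
have [s [qs st Zs nZ]] : exists s, [/\ q <= s, s <= t, Z z s \/ s = t &
    forall v, 0 < v < s -> ~ Z z' v].
  (* [s] is the hitting time from [z'], or [t] if it comes first. *)
  have [[v Zv vt]|nv] := pselect (exists2 v, Z z' v & v <= t).
    have [s [Zs sv smin]] := hitP _ _ Zv; exists s; split.
    - by apply/ltW/(right_hit z').
    - exact: le_trans vt.
    - by left; exact: (ZS _ _ (ltW zz')).
    - by move=> k /andP[_ ks] /smin; rewrite leNgt ks.
  exists t; split => //; [exact: ltW|by right|].
  by move=> v /andP[_ vt] Zv; apply: nv; exists v => //; exact: ltW.
apply: (@gap_product_gain _ t _ _ u s c (q - e) q) => //.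
- exact: (Zgt0 zc).
- by apply: cmin; apply: (ZS _ _ (ltW zcz')).
- by rewrite gtrBl.
- exact: (ZS _ _ (ltW zz')).
Qed.

Lemma flow_factor_discontinuous x1 x2 U : 0 < x2 ->
  (hitting_time phi (vec2 x1 x2) < t%:E)%E -> nbhs (vec2 x1 x2) U ->
  exists y, [/\ U y, half_plane y &
    ~ half_plane_continuous_at (flow_factor phi t) y].
Proof.
move=> x20 ht nU; have hp u := half_plane_vec2 u x20.
have /nbhs_ballP[e /= e0 He] := continuous_vec2 nU.
have [a] := flow_factor_jump x20 e0 ht.
rewrite in_itv/= => /andP[ax xa] [l [r [lr gl gr]]].
exists (vec2 a x2); split => //.
  by apply: He; rewrite /ball/= distrC ltr_distl ax xa.
move=> cf.
have ca : flow_factor phi t (vec2 z x2) @[z --> a] --> flow_factor phi t (vec2 a x2).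
  apply: (cvg_comp (fun z => vec2 z x2) (flow_factor phi t) _ cf).
  move=> B wB.
  have : \forall z \near a, half_plane (vec2 z x2) -> B (vec2 z x2).
    exact: continuous_vec2 wB.
  by apply: filterS => z; apply; exact: hp.
have el : l = flow_factor phi t (vec2 a x2).
  apply: (cvg_unique _ gl); first exact: Rhausdorff.
  exact: cvg_at_left_filter.
have er : r = flow_factor phi t (vec2 a x2).
  apply: (cvg_unique _ gr); first exact: Rhausdorff.
  exact: cvg_at_right_filter.
by move: lr; rewrite el er eqxx.
Qed.

End Path.

(** * Almost sure statements *)

Section Flow.
Context {R : realType} (d : measure_display) (Omega : measurableType d).
Variables (P : probability Omega R) (w : R -> Omega -> 'cV[R]_2)
  (phi : Omega -> R -> 'cV[R]_2 -> 'cV[R]_2)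
  (L : Omega -> R -> 'cV[R]_2 -> R).
Hypotheses (hw : wiener_process P w)
  (hphi : forall omega, reflecting_flow (w^~ omega) (phi omega) (L omega)).

(** The null set does not depend on the starting point. *)
Lemma boundary_at_negligible q : 0 < q ->
  P.-negligible [set omega | exists2 x, half_plane x &
    boundary (phi omega q x)].
Proof.
move=> q0; apply: negligibleS (wiener_left_lipschitz_negligible hw q0).
move=> omega [x hx bq].
exact: (boundary_left_lipschitz (flow_continuous_time (hphi omega) hx)
  ((hphi omega).2 _ hx) q0 bq).
Qed.

Lemma boundary_at_rationals_negligible t : 0 < t ->
  P.-negligible [set omega |
    ~ ((forall (r : rat) x, 0 < ratr r :> R -> half_plane x ->
          ~ boundary (phi omega (ratr r) x)) /\
       (forall x, half_plane x -> ~ boundary (phi omega t x)))].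
Proof.
move=> t0.
pose S q := [set omega | 0 < q /\ exists2 x, half_plane x &
  boundary (phi omega q x)].
have nS q : P.-negligible (S q).
  have [q0|q0] := ltP 0 q.
    by apply: negligibleS (boundary_at_negligible q0) => omega [].
  apply: negligibleS (@negligible_set0 _ _ _ P) => omega [].
  by rewrite ltNge q0.
pose Q (n : nat) := S (ratr (odflt 0 (choice.unpickle n : option rat))).
have : P.-negligible (S t `|` \bigcup_n Q n).
  by apply: negligibleU => //; apply: negligible_bigcup => n; exact: nS.
apply: negligibleS.
move=> omega; apply: contra_notP => /not_orP[nt nr]; split => [r x r0 hx b|x hx b].
  apply: nr; exists (choice.pickle r) => //; rewrite /Q choice.pickleK/=.
  by split => //; exists x.
by apply: nt; split => //; exists x.
Qed.

End Flow.

Theorem theorem5 (R : realType) (d : measure_display) (Omega : measurableType d)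
    (P : probability Omega R) (w : R -> Omega -> 'cV[R]_2)
    (phi : Omega -> R -> 'cV[R]_2 -> 'cV[R]_2)
    (L : Omega -> R -> 'cV[R]_2 -> R)
    (hw : wiener_process P w)
    (hphi : forall omega, reflecting_flow (w^~ omega) (phi omega) (L omega))
    (t : R) (ht : 0 < t) :
  (forall x2 : R, 0 < x2 ->
     {ae P, forall omega, forall a b : R, a <= b ->
        flow_factor (phi omega) t (vec2 a x2) <=
        flow_factor (phi omega) t (vec2 b x2)}) /\
  (forall x1 x2 : R, 0 < x2 ->
     {ae P, forall omega,
        (hitting_time (phi omega) (vec2 x1 x2) < t%:E)%E ->
        forall U : set 'cV[R]_2, nbhs (vec2 x1 x2) U ->
          exists y : 'cV[R]_2, [/\ U y, half_plane y &
            ~ half_plane_continuous_at (flow_factor (phi omega) t) y]}) /\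
  (forall x1 x2 delta : R, 0 < x2 -> 0 < delta ->
     P.-negligible
       ([set omega | ~ exists2 a : R, a \in `]x1 - delta, x1 + delta[ &
           jump_discontinuity
             (fun z => flow_factor (phi omega) t (vec2 z x2)) a]
        `&` [set omega |
               (hitting_time (phi omega) (vec2 x1 x2) < t%:E)%E])).
Proof.
have W0 omega : w 0 omega = 0 by have [] := hw.
have N := boundary_at_rationals_negligible hw hphi ht.
split; [|split].
- move=> x2 x20; apply: negligibleS N => omega; apply: contra_not => -[nr nt].
  by move=> a b ab; exact: (flow_factor_le (W0 omega) (hphi omega) ht nt).
- move=> x1 x2 x20; apply: negligibleS N => omega; apply: contra_not => -[nr nt].
  move=> hit U nU.
  exact: (flow_factor_discontinuous (W0 omega) (hphi omega) ht nr nt x20 hit nU).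
- move=> x1 x2 delta x20 delta0; apply: negligibleS N => omega [] /= + hit.
  apply: contra_not => -[nr nt].
  exact: (flow_factor_jump (W0 omega) (hphi omega) ht nr nt x20 delta0 hit).
Qed.
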